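(* For each $p\in(1,\infty)$ and $t\in[0,1)$ the operator $C_t\in\mathcal{L}(bv_p)$ is compact with spectra $$\sigma_{pt}(C_t;bv_p)=\Lambda\quad\text{and}\quad\sigma(C_t;bv_p)=\Lambda_0.$$ Moreover, $C_t\in\mathcal{L}(bv_p)$ is power bounded and uniformly mean ergodic, but not supercyclic.
   Context: Sequences are complex and indexed by $\mathbb{N}_0=\{0,1,2,\dots\}$; $\omega=\mathbb{C}^{\mathbb{N}_0}$. For $1<p<\infty$, $bv_p$ is the Banach space $\{x\in\omega:\|x\|_{bv_p}:=\big(|x_0|^p+\sum_{k=0}^\infty|x_{k+1}-x_k|^p\big)^{1/p}<\infty\}$. For $t\in[0,1]$ the generalized Cesàro operator is $C_tx=\big(\frac{t^nx_0+t^{n-1}x_1+\dots+x_n}{n+1}\big)_{n\in\mathbb{N}_0}$, with $t^0=1$ also for $t=0$. $\Lambda:=\{\frac1{n+1}:n\in\mathbb{N}_0\}$ and $\Lambda_0:=\Lambda\cup\{0\}$. $\mathcal{L}(X)$ is the space of bounded linear operators on a Banach space $X$; $\sigma(T;X)$ and $\sigma_{pt}(T;X)$ are the spectrum and point spectrum (set of eigenvalues) of $T$. With $T_{[n]}:=\frac1n\sum_{m=1}^nT^m$, $T$ is uniformly mean ergodic if $(T_{[n]})_{n\geq 1}$ converges in operator norm; power bounded if $\sup_{n\ge1}\|T^n\|<\infty$; supercyclic if there is $x\in X$ with $\{\lambda T^nx:\lambda\in\mathbb{C},n\in\mathbb{N}_0\}$ dense in $X$. *)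

(* Defs.v *)
From HB Require Import structures.
From mathcomp Require Import all_boot all_order all_algebra.
From mathcomp Require Import all_classical all_reals all_analysis.
From mathcomp Require Import complex.

Set Implicit Arguments.
Unset Strict Implicit.
Unset Printing Implicit Defensive.

Import Order.TTheory GRing.Theory Num.Theory.
Import numFieldNormedType.Exports.
Import ComplexField.Normc.

Local Open Scope classical_set_scope.
Local Open Scope ring_scope.
Local Open Scope complex_scope.

Section BanachOperators.
Variables (R : realType) (X : completeNormedModType R[i]).
Implicit Types (T : X -> X).

(* The norm of a normed module over [R[i]] takes its values in [R[i]]; they are
   real and nonnegative. *)
Definition rnorm (x : X) : R := complex.Re `|x|.

Definition bounded_op T : Prop :=
  linear T /\ exists M : R, forall x, rnorm (T x) <= M * rnorm x.

(* Extended-real valued, hence meaningful for unbounded [T] as well. *)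
Definition opnorm T : \bar R :=
  ereal_sup [set (rnorm (T x))%:E | x in [set x | rnorm x <= 1]].

Definition compact_op T : Prop :=
  precompact (T @` [set x | rnorm x <= 1]).

Definition point_spectrum T : set R[i] :=
  [set l | exists2 x, x != 0 & T x = l *: x].

Definition resolvent_set T : set R[i] :=
  [set l | exists S : X -> X, [/\ bounded_op S,
     cancel (fun x => l *: x - T x) S & cancel S (fun x => l *: x - T x)]].

Definition spectrum T : set R[i] := ~` resolvent_set T.

Definition power_bounded T : Prop :=
  (ereal_sup [set opnorm (iter n T) | n in [set n | (1 <= n)%N]] < +oo)%E.

Definition cesaro_mean T (n : nat) (x : X) : X :=
  n%:R^-1 *: \sum_(1 <= m < n.+1) iter m T x.

Definition uniformly_mean_ergodic T : Prop :=
  exists2 P : X -> X, bounded_op P &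
    opnorm (fun x => cesaro_mean T n x - P x) @[n --> \oo] --> 0%E.

Definition supercyclic T : Prop :=
  exists x : X, dense [set y | exists (l : R[i]) (n : nat), y = l *: iter n T x].

End BanachOperators.

Section bv.
Variables (R : realType) (p : R).
Local Notation C := R[i].
Implicit Types x y : nat -> C.

(* Extended-real valued; for [0 < p] the outer power sends [+oo] to [+oo], so
   that [bvnorm x < +oo] says exactly that the series converges. *)
Definition bvnorm x : \bar R :=
  (((normc (x 0%N) `^ p)%:E
    + \sum_(0 <= k <oo) (normc (x k.+1 - x k) `^ p)%:E) `^ p^-1)%E.

(* [x |-> bvdiff x] is the isometry of [bv_p] onto [l_p]. *)
Definition bvdiff x (k : nat) : C := if k is j.+1 then x k - x j else x 0%N.

Lemma normc_ge0 (z : C) : 0 <= normc z.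
Proof. by case: z => a b; exact: sqrtr_ge0. Qed.

Lemma norm_normc (z : C) : `|normc z| = normc z.
Proof. by rewrite ger0_norm// normc_ge0. Qed.

Lemma bvnormE x : 0 < p ->
  bvnorm x = Lnorm counting p%:E (EFin \o (fun k => normc (bvdiff x k))).
Proof.
move=> p0; rewrite Lnorm_counting// /bvnorm; congr (_ `^ _)%E.
rewrite [RHS](nneseries_recl (P := xpredT)); last 2 first.
- by move=> k _; exact: poweR_ge0.
- by [].
rewrite /= norm_normc; congr (_ + _)%E.
rewrite -[RHS]nneseries_addn; last by move=> k; rewrite lee_fin powR_ge0.
by apply: eq_eseriesr => k _; rewrite addn1 /= norm_normc.
Qed.

Lemma bvnorm_ge0 x : (0 <= bvnorm x)%E.
Proof. exact: poweR_ge0. Qed.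

Lemma bvdiffD x y k : bvdiff (x + y) k = bvdiff x k + bvdiff y k.
Proof. by case: k => [|k] //=; rewrite !fctE opprD addrACA. Qed.

Lemma bvdiffZ a x k : bvdiff (fun n => a * x n) k = a * bvdiff x k.
Proof. by case: k => [|k] //=; rewrite mulrBr. Qed.

Hypothesis p1 : 1 < p.
Let p0 : 0 < p := lt_trans ltr01 p1.

Lemma le_Lnorm_counting (f g : nat -> R) : (forall k, 0 <= f k <= g k) ->
  (Lnorm counting p%:E (EFin \o f) <= Lnorm counting p%:E (EFin \o g))%E.
Proof.
move=> fg; rewrite !Lnorm_counting//.
rewrite gt0_ler_poweR ?invr_ge0 ?(ltW p0)//.
- by rewrite in_itv/= leey andbT nneseries_ge0// => *; exact: poweR_ge0.
- by rewrite in_itv/= leey andbT nneseries_ge0// => *; exact: poweR_ge0.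
apply: lee_nneseries => [k _ _|k _]; first exact: poweR_ge0.
have /andP[f0 fg0] := fg k.
rewrite /= lee_fin ge0_ler_powR ?nnegrE ?(ltW p0)//.
by rewrite !ger0_norm// (le_trans f0).
Qed.

Lemma bvnormD x y : (bvnorm (x + y)%R <= bvnorm x + bvnorm y)%E.
Proof.
rewrite !bvnormE//.
pose f k : R := normc (bvdiff x k); pose g k : R := normc (bvdiff y k).
have fg : (Lnorm counting p%:E (EFin \o (fun k => normc (bvdiff (x + y)%R k))) <=
  Lnorm counting p%:E (EFin \o (f \+ g)%R))%E.
  apply: le_Lnorm_counting => k; rewrite normc_ge0/= bvdiffD.
  exact: le_normcD.
apply: (le_trans fg).
by apply: minkowski_EFin => //; exact: ltW.
Qed.

Lemma bvnormZ a x :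
  (bvnorm (fun n => a * x n)%R = (normc a)%:E * bvnorm x)%E.
Proof.
rewrite !bvnormE// !Lnorm_counting//.
have -> : (normc a)%:E = (((normc a) `^ p)%:E `^ p^-1)%E.
  by rewrite poweR_EFin -powRrM divff ?gt_eqF// powRr1 ?normc_ge0.
rewrite -poweRM ?lee_fin ?powR_ge0//; last first.
  by apply: nneseries_ge0 => *; exact: poweR_ge0.
congr (_ `^ _)%E; rewrite -nneseriesZl; last by move=> *; exact: poweR_ge0.
apply: eq_eseriesr => k _ /=.
by rewrite bvdiffZ !norm_normc normcM powRM ?normc_ge0// EFinM.
Qed.

Lemma le_bvdiff x k : ((normc (bvdiff x k))%:E <= bvnorm x)%E.
Proof.
rewrite bvnormE// Lnorm_counting//.
have -> : (normc (bvdiff x k))%:E = (((normc (bvdiff x k)) `^ p)%:E `^ p^-1)%E.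
  by rewrite poweR_EFin -powRrM divff ?gt_eqF// powRr1 ?normc_ge0.
rewrite gt0_ler_poweR ?invr_ge0 ?(ltW p0)//.
- by rewrite in_itv/= leey andbT lee_fin powR_ge0.
- by rewrite in_itv/= leey andbT nneseries_ge0// => *; exact: poweR_ge0.
rewrite (nneseriesD1 (n := k) (P := xpredT))//; last by move=> *; exact: poweR_ge0.
rewrite /= norm_normc leeDl// nneseries_ge0// => *; exact: poweR_ge0.
Qed.

Lemma bvdiff0 x : (forall k, bvdiff x k = 0) -> x = 0.
Proof.
move=> dx; apply/funext => n; elim: n => [|n IH]; first exact: dx 0%N.
by have := dx n.+1; rewrite /= IH subr0.
Qed.

Lemma bvnorm0_eq0 x : bvnorm x = 0%E -> x = 0.
Proof.
move=> x0; apply: bvdiff0 => k; apply: eq0_normc; apply/eqP.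
by rewrite eq_le normc_ge0 andbT; have := le_bvdiff x k; rewrite x0 lee_fin.
Qed.

Lemma bvnorm0 : bvnorm 0 = 0%E.
Proof.
have -> : (0 : nat -> C) = (fun n => 0 * (0 : nat -> C) n).
  by apply/funext => n; rewrite mul0r.
by rewrite bvnormZ normc0 mul0e.
Qed.

Lemma bvnormN x : bvnorm (- x) = bvnorm x.
Proof.
have -> : - x = (fun n => (- 1) * x n).
  by apply/funext => n; rewrite mulN1r.
by rewrite bvnormZ (_ : normc (-1) = 1) ?mul1e// normcN normc1.
Qed.

End bv.

(* The proof of [1 < p] is an argument so that the algebraic structures, which
   rest on Minkowski's inequality, can be attached to [bv_pred] and [bv]. *)
Definition bv_pred (R : realType) (p : R) (p1 : 1 < p) : {pred (nat -> R[i])} :=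
  fun x => (bvnorm p x < +oo)%E.

Record bv (R : realType) (p : R) (p1 : 1 < p) :=
  BV { bvseq :> nat -> R[i]; bvseqP : bvseq \in bv_pred p1 }.

Section bv_structures.
Variables (R : realType) (p : R) (p1 : 1 < p).
Local Notation C := R[i].
Local Notation V := (bv p1).

Lemma bv_zmod_closed : zmod_closed (bv_pred p1).
Proof.
split=> [|x y xp yp]; rewrite /in_mem/= /bv_pred; first by rewrite bvnorm0.
by rewrite (le_lt_trans (bvnormD p1 _ _))// bvnormN// lte_add_pinfty.
Qed.

HB.instance Definition _ :=
  GRing.isZmodClosed.Build (nat -> C) (bv_pred p1) bv_zmod_closed.

HB.instance Definition _ := [isSub for @bvseq R p p1].
HB.instance Definition _ := [Choice of V by <:].
HB.instance Definition _ := [SubChoice_isSubZmodule of V by <:].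

Lemma bv_scale_subproof (a : C) (x : V) :
  (fun n => a * x n) \in bv_pred p1.
Proof.
by rewrite /in_mem/= /bv_pred bvnormZ// lte_mul_pinfty ?lee_fin ?normc_ge0//;
  exact: bvseqP.
Qed.

Definition bv_scale (a : C) (x : V) : V := BV (bv_scale_subproof a x).

Lemma bv_eqP (x y : V) : (forall n, x n = y n) -> x = y.
Proof. by move=> xy; apply: val_inj; apply/funext. Qed.

Lemma bvD (x y : V) n : (x + y) n = x n + y n.
Proof. by []. Qed.

Lemma bvN (x : V) n : (- x) n = - x n.
Proof. by []. Qed.

Fact bv_scaleA a b (x : V) : bv_scale a (bv_scale b x) = bv_scale (a * b) x.
Proof. by apply: bv_eqP => n /=; rewrite mulrA. Qed.

Fact bv_scale1 : left_id 1 bv_scale.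
Proof. by move=> x; apply: bv_eqP => n /=; rewrite mul1r. Qed.

Fact bv_scaleDr : right_distributive bv_scale +%R.
Proof. by move=> a x y; apply: bv_eqP => n; rewrite bvD /= mulrDr. Qed.

Fact bv_scaleDl x : {morph bv_scale^~ x : a b / a + b}.
Proof. by move=> a b; apply: bv_eqP => n; rewrite bvD /= mulrDl. Qed.

HB.instance Definition _ := GRing.Zmodule_isLmodule.Build C V
  bv_scaleA bv_scale1 bv_scaleDr bv_scaleDl.

Lemma bvZ (a : C) (x : V) n : (a *: x) n = a * x n.
Proof. by []. Qed.

Definition bvnormr (x : V) : C := (fine (bvnorm p x))%:C.

Lemma bv_fin_num (x : V) : bvnorm p x \is a fin_num.
Proof. by rewrite ge0_fin_numE ?bvnorm_ge0//; exact: bvseqP. Qed.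

Fact bvnormrD (x y : V) : bvnormr (x + y) <= bvnormr x + bvnormr y.
Proof.
have : fine (bvnorm p (x + y)) <= fine (bvnorm p x) + fine (bvnorm p y).
  rewrite -lee_fin EFinD (fineK (bv_fin_num x)) (fineK (bv_fin_num y)).
  by rewrite (fineK (bv_fin_num (x + y))); exact: bvnormD.
by rewrite -lecR (rmorphD (real_complex R)).
Qed.

Fact bvnormrZ (a : C) (x : V) : bvnormr (a *: x) = `|a| * bvnormr x.
Proof.
have -> : bvnormr (a *: x) = (normc a * fine (bvnorm p x))%:C.
  congr (_ %:C); rewrite -[RHS]/(fine (normc a)%:E * _) -fineM ?bv_fin_num//.
  by congr fine; exact: bvnormZ.
by rewrite (rmorphM (real_complex R)).
Qed.

Fact bvnormr0_eq0 (x : V) : bvnormr x = 0 -> x = 0.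
Proof.
move=> [x0]; apply: val_inj; apply: (bvnorm0_eq0 p1).
by rewrite -[LHS]fineK ?bv_fin_num// x0.
Qed.

HB.instance Definition _ := @Lmodule_isNormed.Build C V bvnormr
  bvnormrD bvnormrZ bvnormr0_eq0.

Lemma bv_normE (x : V) : `|x| = (fine (bvnorm p x))%:C.
Proof. by []. Qed.

End bv_structures.

Section bv_complete.
Variables (R : realType) (p : R) (p1 : 1 < p).
Local Notation C := R[i].
Local Notation V := (bv p1).
Let p0 : 0 < p := lt_trans ltr01 p1.

Let bvd (x : V) k : C := bvdiff x k.

Let bvdB (x y : V) k : bvd (x - y) k = bvd x k - bvd y k.
Proof.
case: k => [|k] //.
rewrite -[LHS]/((x k.+1 - y k.+1) - (x k - y k)).
by rewrite -[RHS]/((x k.+1 - x k) - (y k.+1 - y k)) !opprD !opprK addrACA.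
Qed.

Let le_bvd (x : V) (e : R) k : `|x| < e%:C -> normc (bvd x k) < e.
Proof.
rewrite bv_normE ltcR; apply: le_lt_trans.
by rewrite -lee_fin (fineK (bv_fin_num x)); exact: le_bvdiff.
Qed.

Let re_le (z : C) : `|complex.Re z| <= normc z.
Proof. by rewrite -lecR; exact: normc_ge_Re. Qed.

Let im_le (z : C) : `|complex.Im z| <= normc z.
Proof.
case: z => a b /=; rewrite -sqrtr_sqr ler_sqrt ?addr_ge0 ?sqr_ge0//.
by rewrite lerDr sqr_ge0.
Qed.

Let normc_le (z : C) : normc z <= `|complex.Re z| + `|complex.Im z|.
Proof.
case: z => a b /=; rewrite -(ger0_norm (addr_ge0 (normr_ge0 a) (normr_ge0 b))).
rewrite -sqrtr_sqr ler_sqrt ?sqr_ge0// sqrrD !real_normK ?num_real//.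
by rewrite lerD2r lerDl mulrn_wge0// mulr_ge0.
Qed.

Let n2 : normc (2 : C) = 2 :> R.
Proof.
by rewrite -[LHS]/(complex.Re `|2 : C|) ger0_norm ?ler0n.
Qed.

Let half_le (b c d : R) : b <= c + d -> d < b / 2 -> b <= 2 * c.
Proof.
move=> h db; have : b < c + b / 2 by rewrite (le_lt_trans h)// ltrD2l.
rewrite {1}[b]splitr ltrD2r ltr_pdivrMr// mulrC; exact: ltW.
Qed.

Let cauchy_dist (F : set_system V) : ProperFilter F -> cauchy F ->
  forall e : R, 0 < e -> exists A : set V,
    F A /\ forall x y, A x -> A y -> `|x - y| < e%:C.
Proof.
move=> FF /cauchy_ballP Fc e e0.
have e20 : 0 < (e / 2)%:C :> C by rewrite ltcR divr_gt0.
have /cauchyP/(_ _ e20)[z Fz] : cauchy F by apply/cauchy_ballP.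
exists (ball z (e / 2)%:C); split=> // x y; rewrite -ball_normE/= => zx zy.
rewrite (_ : x - y = (z - y) - (z - x)); last by rewrite opprB [RHS]addrC subrKA.
rewrite (le_lt_trans (ler_normB _ _))// [e]splitr (rmorphD (real_complex R)).
exact: ltrD.
Qed.

Let coord_cvg (F : set_system V) (f : V -> R) : ProperFilter F -> cauchy F ->
  (forall (x y : V) e, `|x - y| < e%:C -> `|f x - f y| < e) ->
  cvg (f @ F).
Proof.
move=> FF Fc flip; apply/cauchy_cvgP/cauchy_ballP => e e0.
have [A [FA Ae]] := cauchy_dist FF Fc e0.
have FfA : F (f @^-1` (f @` A)) by apply: (filterS _ FA) => x Ax; exists x.
exists (f @` A, f @` A) => //.
move=> [_ _] [/= [x Ax <-] [y Ay <-]]; rewrite -ball_normE/=.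
by apply: flip; exact: Ae.
Qed.

Lemma bv_cauchy_cvg (F : set_system V) : ProperFilter F -> cauchy F -> cvg F.
Proof.
move=> FF Fc.
have cRe k : cvg ((fun x => complex.Re (bvd x k)) @ F).
  apply: coord_cvg => // x y e xye.
  rewrite -raddfB (le_lt_trans (re_le _))//.
  by rewrite -bvdB; exact: le_bvd.
have cIm k : cvg ((fun x => complex.Im (bvd x k)) @ F).
  apply: coord_cvg => // x y e xye.
  rewrite -raddfB (le_lt_trans (im_le _))//.
  by rewrite -bvdB; exact: le_bvd.
pose D k : C := (lim ((fun x => complex.Re (bvd x k)) @ F))
  +i* (lim ((fun x => complex.Im (bvd x k)) @ F)).
have Dcvg k (e : R) : 0 < e -> \forall z \near F, normc (bvd z k - D k) < e.
  move=> e0; have e20 : 0 < e / 2 by rewrite divr_gt0.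
  have /cvgrPdist_lt/(_ _ e20) h1 := cRe k.
  have /cvgrPdist_lt/(_ _ e20) h2 := cIm k.
  near=> z.
  rewrite (le_lt_trans (normc_le _))// [e]splitr ltrD//.
    by rewrite raddfB/= distrC; near: z; exact: h1.
  by rewrite raddfB/= distrC; near: z; exact: h2.
pose l n : C := \sum_(i < n.+1) D i.
have dl k : bvdiff l k = D k.
  case: k => [|k]; rewrite /= /l ?big_ord1//.
  by rewrite big_ord_recr/= [X in X - _]addrC addrK.
have key (e : R) : 0 < e -> exists2 A : set V, F A & forall y, A y ->
    (bvnorm p ((y : nat -> C) - l)%R <= (2 * e)%:E)%E.
  move=> e0; have [A [FA Ae]] := cauchy_dist FF Fc e0.
  exists A => // y Ay.
  have dyl k : bvdiff ((y : nat -> C) - l) k = bvd y k - D k.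
    by rewrite -dl /bvd; case: k => [|k] //=; rewrite !fctE !opprD addrACA opprK.
  have fin N : \forall z \near F, forall k, (k < N)%N ->
      normc (bvd y k - D k) <= normc (2 * bvd (y - z) k).
    elim: N => [|N IH]; first by near=> z.
    have [yN|yN] := eqVneq (normc (bvd y N - D N)) 0.
      near=> z => k; rewrite ltnS leq_eqVlt => /predU1P[->|].
        by rewrite yN normc_ge0.
      by move: k; near: z.
    have a0 : 0 < normc (bvd y N - D N) / 2.
      by rewrite divr_gt0// lt_neqAle eq_sym yN normc_ge0.
    near=> z => k; rewrite ltnS leq_eqVlt => /predU1P[->|]; last first.
      by move: k; near: z.
    have zN : normc (bvd z N - D N) < normc (bvd y N - D N) / 2.
      by near: z; exact: Dcvg.
    have := le_normcD (bvd y N - bvd z N) (bvd z N - D N).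
    rewrite subrKA bvdB normcM n2 => h.
    exact: half_le h zN.
  have -> : ((2 * e)%:E = ((2 * e) `^ p)%:E `^ p^-1)%E.
    by rewrite poweR_EFin -powRrM divff ?gt_eqF// powRr1// mulr_ge0// ltW.
  rewrite bvnormE// Lnorm_counting// gt0_ler_poweR ?invr_ge0 ?(ltW p0)//.
  - by rewrite in_itv/= leey andbT nneseries_ge0// => *; exact: poweR_ge0.
  - by rewrite in_itv/= leey andbT lee_fin powR_ge0.
  apply: lime_le; first by apply: is_cvg_nneseries => *; exact: poweR_ge0.
  apply: nearW => N.
  have [z [Az zN]] := filter_ex (filterI FA (fin N)).
  have yz : (bvnorm p (2 *: (y - z) : V)%R <= (2 * e)%:E)%E.
    have -> : (bvnorm p (2 *: (y - z) : V)%R = 2%:E * bvnorm p (y - z : V)%R)%E.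
      by rewrite -[in RHS]n2; exact: bvnormZ.
    have := Ae _ _ Ay Az; rewrite bv_normE ltcR => /ltW.
    by rewrite -lee_fin (fineK (bv_fin_num (y - z))) EFinM lee_pmul2l.
  have le1 : (bvnorm p (2 *: (y - z) : V)%R `^ p <= ((2 * e) `^ p)%:E)%E.
    rewrite -poweR_EFin gt0_ler_poweR ?(ltW p0)// in_itv/= leey andbT.
      exact: bvnorm_ge0.
    by rewrite lee_fin mulr_ge0// ltW.
  apply: le_trans le1.
  rewrite bvnormE// Lnorm_counting// -poweRrM mulVf ?gt_eqF// poweRe1; last first.
    by apply: nneseries_ge0 => *; exact: poweR_ge0.
  apply: (le_trans _ (nneseries_lim_ge N _)); last by move=> *; exact: poweR_ge0.
  rewrite !big_mkord; apply: lee_sum => k _ /=.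
  rewrite lee_fin !norm_normc ge0_ler_powR ?nnegrE ?normc_ge0 ?(ltW p0)//.
  rewrite dyl (le_trans (zN k _))//.
  by rewrite -(bvdiffZ 2 (y - z : V)).
have lP : l \in bv_pred p1.
  have [A FA Al] := key 1 ltr01; have [y Ay] := filter_ex FA.
  have yl : (y : nat -> C) - l \in bv_pred p1 by exact: le_lt_trans (Al y Ay) (ltry _).
  have -> : l = (y : nat -> C) - ((y : nat -> C) - l) by rewrite opprB addrC subrK.
  exact: (rpredB (bvseqP y) yl).
apply/cvg_ex; exists (BV lP : V); apply/cvgrPdist_le => e e0.
have /complex_realP[r re] := gtr0_real e0; rewrite re ltcR in e0 *.
have r20 : 0 < r / 2 by rewrite divr_gt0.
have [A FA Al] := key (r / 2) r20; apply: filterS FA => y Ay.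
rewrite distrC bv_normE lecR -lee_fin (fineK (bv_fin_num (y - BV lP))).
by have := Al y Ay; rewrite mulrC divfK.
Unshelve. all: by end_near. Qed.

HB.instance Definition _ := Uniform_isComplete.Build V bv_cauchy_cvg.

End bv_complete.

Section generalized_cesaro.
Variable R : realType.
Local Notation C := R[i].

Definition gen_cesaro (t : R) (x : nat -> C) (n : nat) : C :=
  (\sum_(i < n.+1) t%:C ^+ (n - i) * x i) / n.+1%:R.

Definition Lambda : set C := [set n.+1%:R^-1 | n in [set: nat]].

Definition Lambda0 : set C := Lambda `|` [set 0].

End generalized_cesaro.

Arguments Lambda R : clear implicits.
Arguments Lambda0 R : clear implicits.

(* Main.v *)
Require Import Defs.
From HB Require Import structures.
From mathcomp Require Import all_boot all_order all_algebra.
From mathcomp Require Import all_classical all_reals all_analysis.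
From mathcomp Require Import complex.
From mathcomp Require Import ring lra.

Set Implicit Arguments.
Unset Strict Implicit.
Unset Printing Implicit Defensive.

Import Order.TTheory GRing.Theory Num.Theory.
Import numFieldNormedType.Exports.
Import ComplexField.Normc.

Local Open Scope classical_set_scope.
Local Open Scope ring_scope.

(* Write [d x] for the sequence of differences of [x] ([bvdiff]), so that [bv_p] is
   [l_p] in the coordinates [d]. With [K = 2 / (1 - t)],
     [d (C_t x) (n + 1) = d x (n + 1) / (n + 2) + O(K max_(k <= n) |d x k| / (n + 2))],
   hence [|d (C_t x) n| <= (K + 1) sup |d x| / (n + 1)]. As [1 < p], [C_t] maps all
   sequences with bounded differences into [bv_p], and the image of the unit ball
   lies in a Hilbert cube, which is compact. Everything else can therefore be done
   in the sup norm of [d x], and there with a weight decreasing so fast over finitely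
   many indices that the strictly triangular part of [C_t] becomes negligible next to
   its diagonal [1 / (n + 1)]. This bounds the formal solutions of
   [lam x - C_t x = y] when [lam] is not in [Lambda0], bounds the formal eigenvectors
   for [lam] in [Lambda], and makes [C_t] a contraction on [x 0 = 0], so that the
   powers of [C_t] converge geometrically to a rank-one projection. *)

(** * The complex modulus with values in [R] *)

Section complex_modulus.
Variable R : realType.
Local Notation C := R[i].
Implicit Types a b : C.

Lemma normc_triangle a b : normc (a + b) <= normc a + normc b.
Proof. exact: le_normcD. Qed.

Lemma normc_opp a : normc (- a) = normc a.
Proof. exact: normcN. Qed.

Lemma normc_sub a b : normc (a - b) <= normc a + normc b.
Proof. by rewrite -(normc_opp b) normc_triangle. Qed.

Lemma normc_triangleB a b : normc a - normc b <= normc (a - b).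
Proof. by rewrite lerBlDr; have := normc_triangle (a - b) b; rewrite subrK. Qed.

Lemma normc_real (r : R) : normc r%:C%C = `|r|.
Proof. by rewrite /= expr0n/= addr0 sqrtr_sqr. Qed.

Lemma normc_nat n : normc (n%:R : C) = n%:R.
Proof. by rewrite -(rmorph_nat (real_complex R)) normc_real ger0_norm. Qed.

Lemma normc_natV n : normc (n%:R^-1 : C) = n%:R^-1.
Proof. by rewrite normcV normc_nat. Qed.

Lemma Re_le_normc a : `|complex.Re a| <= normc a.
Proof. by rewrite -lecR; exact: normc_ge_Re. Qed.

Lemma Im_le_normc a : `|complex.Im a| <= normc a.
Proof.
case: a => u v /=; rewrite -sqrtr_sqr ler_sqrt ?addr_ge0 ?sqr_ge0//.
by rewrite lerDr sqr_ge0.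
Qed.

Lemma normc_le_ReIm a : normc a <= `|complex.Re a| + `|complex.Im a|.
Proof.
case: a => u v /=; rewrite -(ger0_norm (addr_ge0 (normr_ge0 u) (normr_ge0 v))).
rewrite -sqrtr_sqr ler_sqrt ?sqr_ge0// sqrrD !real_normK ?num_real//.
by rewrite lerD2r lerDl mulrn_wge0// mulr_ge0.
Qed.

End complex_modulus.

(** * Partial sums of the zeta series *)

Section zeta.
Variable R : realType.
Implicit Types (p s u : R) (n N : nat).

(** From [expR y >= 1 + y] and [ln (1 + u) >= u / (1 + u)]. Unlike the usual lower bound
    [1 + s * u], this one also covers [s < 1]. *)
Lemma bernoulli_powR s u : 0 <= s -> 0 <= u ->
  1 + s * (u / (1 + u)) <= (1 + u) `^ s.
Proof.
move=> s0 u0; have u1 : 0 < 1 + u by lra.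
rewrite /powR gt_eqF// (le_trans _ (expR_ge1Dx _))// lerD2l ler_wpM2l//.
have -> : u / (1 + u) = - ((1 + u)^-1 - 1) by field; rewrite gt_eqF.
rewrite lerNl -lnV ?posrE//.
rewrite -[X in ln X](subrK 1) [X in ln X]addrC le_ln1Dx//.
by rewrite -[X in X < _]add0r ltrD2r invr_gt0.
Qed.

(* The comparison with the telescoping series of [n `^ (1 - p)]. *)
Lemma powRN_telescope p n : 1 < p ->
  (p - 1) * (n.+2%:R `^ p)^-1 <= n.+1%:R `^ (1 - p) - n.+2%:R `^ (1 - p).
Proof.
move=> p1; have s0 : 0 <= p - 1 by lra.
have h : 1 + n.+1%:R^-1 = n.+2%:R / n.+1%:R :> R.
  by rewrite -[n.+2]addn1 natrD mulrDl divff// mul1r.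
have q : n.+2%:R `^ p = n.+2%:R * n.+2%:R `^ (p - 1) :> R.
  rewrite -{2}[n.+2%:R](@powRr1 _ n.+2%:R)// -powRD ?subrKC//.
  by rewrite pnatr_eq0 implybT.
have := @bernoulli_powR (p - 1) n.+1%:R^-1 s0 (ltac:(by rewrite invr_ge0)).
have hu : n.+1%:R^-1 / (n.+2%:R / n.+1%:R) = n.+2%:R^-1 :> R.
  by rewrite invf_div mulrA mulVf// mul1r.
rewrite h hu powRM ?invr_ge0//.
rewrite -[n.+1%:R^-1]powR_inv1// -powRrM mulN1r opprB.
have e : n.+2%:R `^ (1 - p) = (n.+2%:R `^ (p - 1))^-1 :> R by rewrite -powRN opprB.
rewrite e q invfM.
have a0 : 0 < n.+2%:R `^ (p - 1) :> R by rewrite powR_gt0.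
move=> le1; rewrite lerBrDr -(ler_pM2l a0) mulrDr divff ?gt_eqF// addrC.
apply: le_trans le1; rewrite lerD2l le_eqVlt; apply/orP; left; apply/eqP.
by field; rewrite gt_eqF//= (_ : _ != 0)// addrC -(natrD _ n 2) pnatr_eq0 addn2.
Qed.

Lemma sum_powRN_le p N : 1 < p ->
  \sum_(i < N) (i.+1%:R `^ p)^-1 <= p / (p - 1).
Proof.
move=> p1; have s0 : 0 < p - 1 by lra.
have pE : p / (p - 1) = 1 + (p - 1)^-1 by field; rewrite gt_eqF.
case: N => [|N]; first by rewrite big_ord0 divr_ge0//; lra.
rewrite big_ord_recl powR1 invr1 pE lerD2l.
rewrite -(ler_pM2l s0) mulfV ?gt_eqF// mulr_sumr.
rewrite -(big_mkord xpredT (fun i => (p - 1) * ((bump 0 i).+1%:R `^ p)^-1)).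
apply: (@le_trans _ _ (\sum_(0 <= i < N)
  (- (i.+2%:R `^ (1 - p)) - - (i.+1%:R `^ (1 - p))))).
  by apply: ler_sum => i _; rewrite opprK [leRHS]addrC; exact: powRN_telescope.
rewrite (telescope_sumr (fun i => - (i.+1%:R `^ (1 - p))))// powR1 opprK.
by rewrite gerDr oppr_le0 powR_ge0.
Qed.

End zeta.

(** * Norm bounds in [bv_p] from partial sums and from decay of the differences *)

Section bv_norm_estimates.
Variables (R : realType) (p : R).
Local Notation C := R[i].
Implicit Types (x : nat -> C) (K eta : R).

(** Since [bvnorm] is extended-real valued, no convergence is assumed: the same bound gives norm
    estimates and membership in [bv_p]. *)
Lemma bvnorm_le x r : 1 < p -> 0 <= r ->
  (forall N, \sum_(k < N) normc (bvdiff x k) `^ p <= r `^ p) ->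
  (bvnorm p x <= r%:E)%E.
Proof.
move=> p1 r0 xr; have p0 : 0 < p := lt_trans ltr01 p1.
have -> : (r%:E = (r `^ p)%:E `^ p^-1)%E.
  by rewrite poweR_EFin -powRrM divff ?gt_eqF// powRr1.
rewrite bvnormE// Lnorm_counting// gt0_ler_poweR ?invr_ge0 ?(ltW p0)//.
- by rewrite in_itv/= leey andbT nneseries_ge0// => *; exact: poweR_ge0.
- by rewrite in_itv/= leey andbT lee_fin powR_ge0.
apply: lime_le; first by apply: is_cvg_nneseries => *; exact: poweR_ge0.
apply: nearW => N; rewrite big_mkord.
under eq_bigr => k _ do rewrite /= norm_normc.
by rewrite sumEFin lee_fin.
Qed.

(* The exponent [p] is split as [(p - 1) / 2 + (p + 1) / 2]: the second factor is
   already summable, so that the first one yields a small constant. *)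
Lemma bvnorm_le_interp x K eta : 1 < p -> 0 <= K -> 0 <= eta ->
  (forall k, normc (bvdiff x k) <= K / k.+1%:R) ->
  (forall k, normc (bvdiff x k) <= eta) ->
  (bvnorm p x <= ((eta `^ ((p - 1) / 2) * (K `^ ((p + 1) / 2) *
    ((p + 1) / (p - 1)))) `^ p^-1)%:E)%E.
Proof.
move=> p1 K0 eta0 xK xeta; have p0 : 0 < p := lt_trans ltr01 p1.
have : 0 < (p - 1) / 2 by lra.
have : 1 < (p + 1) / 2 by lra.
have : p = (p - 1) / 2 + (p + 1) / 2 by field.
have : (p + 1) / 2 / ((p + 1) / 2 - 1) = (p + 1) / (p - 1).
  by field; rewrite !gt_eqF//; lra.
move: ((p - 1) / 2) ((p + 1) / 2) => a b bE pE b1 a0.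
apply: bvnorm_le => // [|N]; first exact: powR_ge0.
have c0 : 0 <= (p + 1) / (p - 1) by rewrite divr_ge0//; lra.
rewrite -powRrM mulVf ?gt_eqF// powRr1; last first.
  by rewrite mulr_ge0 ?powR_ge0// mulr_ge0 ?powR_ge0.
apply: (@le_trans _ _ (\sum_(k < N) eta `^ a * (K `^ b * (k.+1%:R `^ b)^-1))).
  apply: ler_sum => k _.
  rewrite pE powRD; last by rewrite -pE gt_eqF.
  apply: ler_pM; rewrite ?powR_ge0//.
    by apply: ge0_ler_powR; rewrite ?nnegrE ?normc_ge0// ltW.
  have -> : (k.+1%:R `^ b)^-1 = (k.+1%:R^-1) `^ b :> R.
    by rewrite -powRN -mulN1r powRrM powR_inv1.
  rewrite -powRM ?invr_ge0// ge0_ler_powR ?nnegrE ?normc_ge0 ?divr_ge0//.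
  by rewrite ltW// (lt_trans ltr01).
rewrite -!mulr_sumr -bE; do 2 (apply: ler_wpM2l; first exact: powR_ge0).
exact: sum_powRN_le.
Qed.

End bv_norm_estimates.

(** * The generalized Cesàro operator in difference coordinates *)

Section generalized_cesaro_estimates.
Variables (R : realType) (t : R).
Local Notation C := R[i].
Local Notation d := bvdiff.
Implicit Types (x : nat -> C) (B : R) (n : nat).

(** The numerator of [gen_cesaro]. It obeys a first-order recursion in [n], from which [x] can be
    read back. *)
Definition cesaro_sum x n : C := \sum_(i < n.+1) t%:C%C ^+ (n - i) * x i.

Lemma gen_cesaroE x n : gen_cesaro t x n = cesaro_sum x n / n.+1%:R.
Proof. by []. Qed.

Lemma cesaro_sum0 x : cesaro_sum x 0 = x 0%N.
Proof. by rewrite /cesaro_sum big_ord1 expr0 mul1r. Qed.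

Lemma cesaro_sumS x n :
  cesaro_sum x n.+1 = t%:C%C * cesaro_sum x n + x n.+1.
Proof.
rewrite /cesaro_sum big_ord_recr/= subnn expr0 mul1r; congr (_ + _).
rewrite mulr_sumr; apply: eq_bigr => i _.
by rewrite subSn ?exprS ?mulrA// -ltnS.
Qed.

Lemma cesaro_sum_unique x s : s 0%N = x 0%N ->
  (forall n, s n.+1 = t%:C%C * s n + x n.+1) -> cesaro_sum x = s.
Proof.
move=> s0 sS; apply/funext; elim=> [|n IH]; first by rewrite cesaro_sum0.
by rewrite cesaro_sumS IH sS.
Qed.

Lemma gen_cesaroD x y n : gen_cesaro t (x + y) n = gen_cesaro t x n + gen_cesaro t y n.
Proof.
rewrite !gen_cesaroE -mulrDl -big_split/=; congr (_ / _).
by apply: eq_bigr => i _; rewrite mulrDr.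
Qed.

Lemma gen_cesaroZ a x n :
  gen_cesaro t (fun k => a * x k) n = a * gen_cesaro t x n.
Proof.
rewrite !gen_cesaroE mulrA mulr_sumr; congr (_ / _).
by apply: eq_bigr => i _; rewrite mulrCA.
Qed.

Lemma bvdiff_cesaro_sum0 x : d (cesaro_sum x) 0 = d x 0.
Proof. exact: cesaro_sum0. Qed.

Lemma bvdiff_cesaro_sumS x n :
  d (cesaro_sum x) n.+1 = t%:C%C * d (cesaro_sum x) n + d x n.+1.
Proof.
case: n => [|n] /=; first by rewrite cesaro_sumS cesaro_sum0; ring.
by rewrite [in LHS]cesaro_sumS [in X in _ - X]cesaro_sumS; ring.
Qed.

Lemma gen_cesaro_diff0 x : d (gen_cesaro t x) 0 = d x 0.
Proof. by rewrite /= gen_cesaroE cesaro_sum0 divr1. Qed.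

(** Expand [s (n + 1) / (n + 2) - s n / (n + 1)] for [s = cesaro_sum x] and use the recursion for
    the differences of [s]; besides the diagonal term only [x 0, ..., x n] enter. *)
Lemma gen_cesaro_diffS x n : d (gen_cesaro t x) n.+1 - d x n.+1 / n.+2%:R =
  (t%:C%C * d (cesaro_sum x) n - cesaro_sum x n / n.+1%:R) / n.+2%:R.
Proof.
have -> : d x n.+1 = d (cesaro_sum x) n.+1 - t%:C%C * d (cesaro_sum x) n.
  by rewrite bvdiff_cesaro_sumS addrC addKr.
rewrite [d (gen_cesaro t x) _]/= [d (cesaro_sum x) n.+1]/= !gen_cesaroE.
have a0 : n.+1%:R != 0 :> C by rewrite pnatr_eq0.
have b0 : n.+1%:R + 1 != 0 :> C by rewrite natr1 pnatr_eq0.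
rewrite -[n.+2%:R]natr1; move: (n.+1%:R : C) a0 b0 => a a0 b0.
by field; rewrite a0 b0.
Qed.

Hypothesis t01 : 0 <= t < 1.

Lemma bvdiff_cesaro_sum_le x n B :
  (forall k, (k <= n)%N -> normc (d x k) <= B) ->
  normc (d (cesaro_sum x) n) <= B / (1 - t).
Proof.
have [t0 t1] := andP t01; have s0 : 0 < 1 - t by lra.
elim: n => [|n IH] xB.
  rewrite bvdiff_cesaro_sum0 ler_pdivlMr//.
  have := xB 0%N isT; have := normc_ge0 (d x 0%N); nra.
rewrite bvdiff_cesaro_sumS (le_trans (normc_triangle _ _))// normcM.
(* [B / (1 - t)] is the fixed point of [b |-> t * b + B]. *)
have -> : B / (1 - t) = t * (B / (1 - t)) + B by field; rewrite gt_eqF.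
rewrite normc_real ger0_norm// lerD ?xB// ler_wpM2l// IH// => k kn.
by rewrite xB// (leq_trans kn).
Qed.

Lemma cesaro_sum_le x n B :
  (forall k, (k <= n)%N -> normc (d x k) <= B) ->
  normc (cesaro_sum x n) <= n.+1%:R * (B / (1 - t)).
Proof.
elim: n => [|n IH] xB; first by rewrite mul1r; exact: (@bvdiff_cesaro_sum_le x 0).
have -> : cesaro_sum x n.+1 = cesaro_sum x n + d (cesaro_sum x) n.+1.
  by rewrite /= addrC subrK.
rewrite -[n.+2]addn1 natrD mulrDl mul1r (le_trans (normc_triangle _ _))// lerD//.
  by apply: IH => k kn; rewrite xB// (leq_trans kn).
exact: bvdiff_cesaro_sum_le.
Qed.

(** Each of the two terms in [gen_cesaro_diffS] costs a factor [1 / (1 - t)]. *)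
Definition cesaro_const : R := 2 / (1 - t).
Local Notation K := cesaro_const.

Lemma cesaro_const_ge1 : 1 <= K.
Proof.
by have /andP[t0 t1] := t01; rewrite /K ler_pdivlMr; lra.
Qed.

(* In the coordinates [d] the operator is the diagonal matrix [1 / (n + 1)] plus a
   strictly lower triangular part that gains a factor [1 / (n + 1)]. *)
Lemma gen_cesaro_offdiag x n B :
  (forall k, (k <= n)%N -> normc (d x k) <= B) ->
  normc (d (gen_cesaro t x) n.+1 - d x n.+1 / n.+2%:R) <= K * B / n.+2%:R.
Proof.
move=> xB; have [t0 t1] := andP t01; have s0 : 0 < 1 - t by lra.
rewrite gen_cesaro_diffS normcM normc_natV ler_wpM2r ?invr_ge0//.
rewrite (le_trans (normc_sub _ _))// !normcM normc_natV normc_real ger0_norm//.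
have -> : K * B = B / (1 - t) + B / (1 - t) by rewrite /K; field; rewrite gt_eqF.
have h := bvdiff_cesaro_sum_le xB.
apply: lerD.
  by apply: le_trans h; rewrite ler_piMl ?normc_ge0// ltW.
by rewrite ler_pdivrMr// mulrC cesaro_sum_le.
Qed.

Lemma gen_cesaro_decay x B : (forall k, normc (d x k) <= B) ->
  forall n, normc (d (gen_cesaro t x) n) <= (K + 1) * B / n.+1%:R.
Proof.
move=> xB [|n].
  rewrite gen_cesaro_diff0 divr1 (le_trans (xB 0%N))//.
  have := cesaro_const_ge1; have := le_trans (normc_ge0 _) (xB 0%N); nra.
have h := @gen_cesaro_offdiag x n B (fun k _ => xB k).
rewrite -[d (gen_cesaro t x) _](subrK (d x n.+1 / n.+2%:R)).
have -> : (K + 1) * B / n.+2%:R = K * B / n.+2%:R + B / n.+2%:R.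
  by rewrite [(K + 1) * B]mulrDl mul1r mulrDl.
rewrite (le_trans (normc_triangle _ _))// lerD//.
by rewrite normcM normc_natV ler_wpM2r ?invr_ge0.
Qed.

End generalized_cesaro_estimates.

(** * Weighted sup-norm estimates, formal preimages and formal eigenvectors *)

Section generalized_cesaro_weighted.
Variables (R : realType) (t : R).
Local Notation C := R[i].
Local Notation d := bvdiff.
Local Notation T := (gen_cesaro t).
Local Notation K := (cesaro_const t).
Implicit Types (x y : nat -> C) (B eta delta : R) (lam : C) (n : nat).

Lemma invS_le_small (e : R) : 0 < e ->
  exists N, forall n, (N <= n)%N -> n.+1%:R^-1 <= e.
Proof.
move=> e0; exists (Num.bound e^-1) => n Nn.
have h : e^-1 < n.+1%:R.
  rewrite (lt_le_trans (archi_boundP _)) ?invr_ge0 ?(ltW e0)//.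
  by rewrite ler_nat (leq_trans Nn).
by rewrite -[leRHS]invrK lef_pV2 ?posrE ?invr_gt0// ltW.
Qed.

(* The weight decreases geometrically until [1 / (n + 2)] is below [eta]. *)
Lemma exists_weight eta : 0 < eta ->
  exists (w : nat -> R) (c : R), [/\ 0 < c, forall n, c <= w n <= 1,
    forall m n, (m <= n)%N -> w n <= w m &
    forall n, w n.+1 / n.+2%:R <= eta * w n].
Proof.
move=> eta0; have [N hN] := invS_le_small eta0.
pose a := Num.min eta 1.
have a0 : 0 < a by rewrite /a lt_min eta0 ltr01.
have a1 : a <= 1 by rewrite /a ge_min lexx orbT.
have ae : a <= eta by rewrite /a ge_min lexx.
(* Constant from [N] on, where [1 / (n + 2)] is below [eta] by itself. *)
pose w n := a ^+ minn n N.
have wmono m n : (m <= n)%N -> w n <= w m.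
  move=> mn; apply: ler_wiXn2l => //; first exact: ltW.
  by rewrite leq_min geq_minr (leq_trans (geq_minl _ _) mn).
exists w, (a ^+ N); split=> [|n|//|n].
- by rewrite exprn_gt0.
- rewrite /w exprn_ile1 ?(ltW a0)// andbT ler_wiXn2l ?(ltW a0)//.
  exact: geq_minr.
have w0 k : 0 < w k by rewrite /w exprn_gt0.
have [Nn|nN] := leqP N n.
  rewrite mulrC ler_pM ?invr_ge0 ?(ltW (w0 _)) ?wmono//.
  by rewrite hN// (leq_trans Nn).
have -> : w n.+1 = a * w n.
  by rewrite /w (minn_idPl nN) (minn_idPl (ltnW nN)) exprS.
rewrite -mulrA ler_pM ?(ltW a0)// ?divr_ge0 ?(ltW (w0 n))//.
by rewrite ler_piMr ?(ltW (w0 n))// invf_le1// ler1n.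
Qed.

Hypothesis t01 : 0 <= t < 1.

(** Divide by the diagonal entry [lam - 1 / (n + 1)] and bound [w n * normc (d x n)] by induction.
    Three uses: [B = 0] gives injectivity, [B] proportional to the norm of the right-hand side
    bounds the resolvent, and the first alternative at a single index bounds eigenvectors. *)
Lemma gen_cesaro_apriori delta : 0 < delta ->
  exists2 c : R, 0 < c & forall lam x B, 0 <= B ->
    (forall n, normc (d x n) <= B \/
      (delta <= normc (lam - n.+1%:R^-1) /\
       normc (lam * d x n - d (T x) n) <= delta * B)) ->
    forall n, normc (d x n) <= c * B.
Proof.
move=> delta0; have K1 := cesaro_const_ge1 t01.
have K0 : 0 < K by rewrite (lt_le_trans ltr01).
(* With this [eta] the off-diagonal part is at most [2 * K * B * eta = delta * B], the same as the
   residual; hence the bound [2 * B] below. *)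
have eta0 : 0 < delta / (2 * K) by rewrite divr_gt0// mulr_gt0.
have [w [c [c0 cw wmono wstep]]] := exists_weight eta0.
have w0 n : 0 < w n by have /andP[/(lt_le_trans c0)] := cw n.
have w1 n : w n <= 1 by have /andP[] := cw n.
exists (2 / c); first by rewrite divr_gt0.
move=> lam x B B0 H.
suff wx n : w n * normc (d x n) <= 2 * B.
  move=> n; rewrite mulrAC ler_pdivlMr// mulrC (le_trans _ (wx n))//.
  by rewrite ler_wpM2r ?normc_ge0//; have /andP[] := cw n.
elim/ltn_ind: n => n IH.
have wB : w n * B <= B by rewrite ler_piMl.
have [xB|[gap res]] := H n.
  by rewrite (@le_trans _ _ (w n * B)) ?ler_wpM2l ?(ltW (w0 n))//; lra.
case: n IH wB gap res => [|n] IH wB gap res.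
  rewrite gen_cesaro_diff0 -{2}[d x 0%N]mul1r -mulrBl normcM invr1 in gap res.
  have xB : normc (d x 0%N) <= B.
    rewrite -(ler_pM2l delta0); apply: le_trans res.
    by rewrite ler_wpM2r ?normc_ge0.
  by rewrite (@le_trans _ _ (w 0%N * B)) ?ler_wpM2l ?(ltW (w0 _))//; lra.
have xk k : (k <= n)%N -> normc (d x k) <= 2 * B / w n.
  move=> kn; rewrite ler_pdivlMr// mulrC (le_trans _ (IH k kn))//.
  by rewrite ler_wpM2r ?normc_ge0// wmono.
have off := gen_cesaro_offdiag t01 xk.
have e : (lam - n.+2%:R^-1) * d x n.+1 = (lam * d x n.+1 - d (T x) n.+1) +
    (d (T x) n.+1 - d x n.+1 / n.+2%:R) by ring.
have le1 : delta * normc (d x n.+1) <=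
    delta * B + K * (2 * B / w n) / n.+2%:R.
  apply: (@le_trans _ _ (normc ((lam - n.+2%:R^-1) * d x n.+1))).
    by rewrite normcM ler_wpM2r ?normc_ge0.
  by rewrite e (le_trans (normc_triangle _ _))// lerD.
have le2 : w n.+1 / n.+2%:R / w n <= delta / (2 * K) by rewrite ler_pdivrMr.
rewrite -(ler_pM2l delta0) mulrCA.
have := ler_wpM2l (ltW (w0 n.+1)) le1; move/le_trans; apply.
have le3 : w n.+1 * (K * (2 * B / w n) / n.+2%:R) <= delta * B.
  have -> : w n.+1 * (K * (2 * B / w n) / n.+2%:R) =
      (2 * K * B) * (w n.+1 / n.+2%:R / w n) by ring.
  have -> : delta * B = (2 * K * B) * (delta / (2 * K)).
    by field; rewrite gt_eqF.
  by rewrite ler_wpM2l// mulr_ge0// mulr_ge0// ltW.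
have le4 : delta * (w n.+1 * B) <= delta * B by rewrite ler_pM2l.
have -> : delta * (2 * B) = delta * B + delta * B by ring.
by rewrite [leLHS]mulrDr lerD// mulrCA.
Qed.

(** On [x 0 = 0] the diagonal entry [1] does not act and the others are at most [1 / 2]; the weight
    pushes the off-diagonal part below [1 / 4], whence [3 / 4]. Passing between the weighted and the
    plain sup norm costs a constant once, independently of [m]. *)
Lemma gen_cesaro_iter_decay : exists2 c : R, 0 < c & forall x B,
  x 0%N = 0 -> (forall n, normc (d x n) <= B) ->
  forall m n, normc (d (iter m T x) n) <= c * B * (3 / 4) ^+ m.
Proof.
have K1 := cesaro_const_ge1 t01; have K0 : 0 < K by rewrite (lt_le_trans ltr01).
have eta0 : 0 < (4 * K)^-1 by rewrite invr_gt0 mulr_gt0.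
have [w [c [c0 cw wmono wstep]]] := exists_weight eta0.
have w0 n : 0 < w n by have /andP[/(lt_le_trans c0)] := cw n.
have w1 n : w n <= 1 by have /andP[] := cw n.
exists c^-1; first by rewrite invr_gt0.
move=> x B x0 xB m.
suff [_ H] : iter m T x 0%N = 0 /\
    forall n, w n * normc (d (iter m T x) n) <= B * (3 / 4) ^+ m.
  move=> n; rewrite -mulrA mulrC ler_pdivlMr// mulrC (le_trans _ (H n))//.
  by rewrite ler_wpM2r ?normc_ge0//; have /andP[] := cw n.
have B0 : 0 <= B := le_trans (normc_ge0 _) (xB 0%N).
elim: m => [|m [y0 IH]].
  split=> // n; rewrite expr0 mulr1 (le_trans _ (xB n))//.
  by rewrite ler_piMl ?normc_ge0.
rewrite iterS exprS mulrCA; set y := iter m T x in y0 IH *.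
move: (B * _) IH => A IH.
have A0 : 0 <= A by rewrite (le_trans _ (IH 0%N))// mulr_ge0 ?normc_ge0// ltW.
have Ty0 : T y 0%N = 0 by rewrite gen_cesaroE cesaro_sum0 y0 mul0r.
split=> // -[|n].
  by rewrite [d _ _]/= Ty0 normc0 mulr0 mulr_ge0.
have yk k : (k <= n)%N -> normc (d y k) <= A / w n.
  move=> kn; rewrite ler_pdivlMr// mulrC (le_trans _ (IH k))//.
  by rewrite ler_wpM2r ?normc_ge0// wmono.
have off := gen_cesaro_offdiag t01 yk.
have le1 : normc (d (T y) n.+1) <=
    normc (d y n.+1) / n.+2%:R + K * (A / w n) / n.+2%:R.
  rewrite -lerBlDl; apply: le_trans off.
  by rewrite -(normc_natV R) -normcM normc_triangleB.
have := ler_wpM2l (ltW (w0 n.+1)) le1; move/le_trans; apply.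
have le2 : w n.+1 / n.+2%:R / w n <= (4 * K)^-1 by rewrite ler_pdivrMr.
have le3 : w n.+1 * (K * (A / w n) / n.+2%:R) <= A / 4.
  have -> : w n.+1 * (K * (A / w n) / n.+2%:R) =
      (K * A) * (w n.+1 / n.+2%:R / w n) by ring.
  have -> : A / 4 = (K * A) * (4 * K)^-1 by field; rewrite gt_eqF.
  by rewrite ler_wpM2l// mulr_ge0// ltW.
have le4 : w n.+1 * (normc (d y n.+1) / n.+2%:R) <= A / 2.
  rewrite mulrA ler_pM ?mulr_ge0 ?normc_ge0 ?invr_ge0 ?(ltW (w0 _))//.
  by rewrite lef_pV2 ?posrE// ler_nat.
have -> : 3 / 4 * A = A / 2 + A / 4 by field.
by rewrite [leLHS]mulrDr lerD.
Qed.

Lemma Lambda_gap lam : lam != 0 -> exists2 delta : R, 0 < delta &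
  forall n, lam != n.+1%:R^-1 -> delta <= normc (lam - n.+1%:R^-1).
Proof.
move=> lam0; have l0 : 0 < normc lam.
  rewrite lt_neqAle normc_ge0 andbT eq_sym; apply: contra lam0 => /eqP.
  by move/eq0_normc ->.
have l20 : 0 < normc lam / 2 by rewrite divr_gt0.
have [N hN] := invS_le_small l20.
suff H M : exists2 delta : R, 0 < delta & forall n, (n < M \/ N <= n)%N ->
    lam != n.+1%:R^-1 -> delta <= normc (lam - n.+1%:R^-1).
  have [delta delta0 hd] := H N; exists delta => // n; apply: hd.
  by case: (ltnP n N); [left|right].
elim: M => [|M [delta delta0 IH]].
  exists (normc lam / 2) => // n [//|/hN h _].
  apply: le_trans (normc_triangleB _ _); rewrite normc_natV lerBrDr.
  by rewrite [leRHS]splitr lerD2l.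
have [lM|lM] := eqVneq lam M.+1%:R^-1.
  exists delta => // n [|Nn ln]; last by apply: IH => //; right.
  rewrite ltnS leq_eqVlt => /predU1P[->|nM ln]; first by rewrite lM eqxx.
  by apply: IH => //; left.
exists (Num.min delta (normc (lam - M.+1%:R^-1))).
  rewrite lt_min delta0 lt_neqAle normc_ge0 andbT eq_sym /=.
  apply: contra lM => /eqP/eq0_normc/eqP; rewrite subr_eq0.
  by [].
move=> n [|Nn ln]; last by rewrite ge_min IH//; right.
rewrite ltnS leq_eqVlt => /predU1P[->|nM] ln; first by rewrite ge_min lexx orbT.
by rewrite ge_min IH//; left.
Qed.

(** Solve for [s = cesaro_sum t x]: as [x (n + 1) = s (n + 1) - t * s n], the equation becomes [(lam
    - 1 / (n + 2)) * s (n + 1) = lam * t * s n + y (n + 1)]. *)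
Lemma exists_gen_cesaro_preimage lam y : (forall n, lam != n.+1%:R^-1) ->
  exists x, forall n, lam * x n - T x n = y n.
Proof.
move=> hl.
pose s := fix s n := if n is m.+1 then t%:C%C * s m +
    (y m.+1 + t%:C%C * s m / m.+2%:R) / (lam - m.+2%:R^-1)
  else y 0%N / (lam - 1).
pose x n := if n is m.+1 then s m.+1 - t%:C%C * s m else s 0%N.
have sx : cesaro_sum t x = s.
  by apply: cesaro_sum_unique => // n; rewrite /x addrC subrK.
exists x => -[|n]; rewrite gen_cesaroE sx.
  have := hl 0%N; rewrite invr1 /x /= -subr_eq0 => l1.
  by field.
rewrite [x _]/= addrAC subrr add0r.
have := hl n.+1; rewrite -subr_eq0 => l1.
have n0 : n.+2%:R != 0 :> C by rewrite pnatr_eq0.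
rewrite [s n.+1]/=; move: (s n) (n.+2%:R : C) l1 n0 => a b l1 n0.
have l2 : b * lam - 1 != 0.
  by rewrite -(divff n0) -mulrBr mulf_neq0.
by field; rewrite n0 mulrC l2.
Qed.

(** The coefficients of [z^k / (1 - t z)^(k + 1)]. For [n < k] the binomial vanishes, so the
    truncated [n - k] does no harm. *)
Definition cesaro_eigenvector k n : C := t%:C%C ^+ (n - k) * 'C(n, k)%:R.

(** By Pascal's rule the sums are [t^(n - k) 'C(n + 1, k + 1)]; then [(n + 1) 'C(n, k) = (k + 1)
    'C(n + 1, k + 1)]. *)
Lemma gen_cesaro_eigenvector k n :
  T (cesaro_eigenvector k) n = k.+1%:R^-1 * cesaro_eigenvector k n.
Proof.
have -> : T (cesaro_eigenvector k) n =
    t%:C%C ^+ (n - k) * 'C(n.+1, k.+1)%:R / n.+1%:R.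
  rewrite gen_cesaroE; congr (_ / _).
  rewrite (@cesaro_sum_unique _ _ _ (fun n => t%:C%C ^+ (n - k) * 'C(n.+1, k.+1)%:R))//.
  move=> m; rewrite /cesaro_eigenvector [in LHS]binS natrD mulrDr; congr (_ + _).
  have [km|mk] := leqP k m; first by rewrite subSn// exprS mulrA.
  by rewrite bin_small ?ltnS// !mulr0.
have := congr1 (fun j => j%:R : C) (mul_bin_diag n.+1 k); rewrite !natrM.
rewrite /cesaro_eigenvector => h; rewrite mulrCA -mulrA; congr (_ * _).
have n0 : n.+1%:R != 0 :> C by rewrite pnatr_eq0.
have k0 : k.+1%:R != 0 :> C by rewrite pnatr_eq0.
apply/eqP; rewrite [_^-1 * _]mulrC eqr_div// [_ * k.+1%:R]mulrC -h.
by rewrite mulrC.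
Qed.

(** The diagonal gap fails only at [n = k], where [normc (d v k)] is its own bound; elsewhere the
    residual is zero. *)
Lemma cesaro_eigenvector_bounded k :
  exists2 B : R, 0 <= B & forall n, normc (d (cesaro_eigenvector k) n) <= B.
Proof.
set v := cesaro_eigenvector k.
have k0 : k.+1%:R^-1 != 0 :> C by rewrite invr_eq0 pnatr_eq0.
have [delta delta0 gap] := Lambda_gap k0.
have [c c0 hc] := gen_cesaro_apriori delta0.
have B0 := normc_ge0 (d v k).
exists (c * normc (d v k)); first by rewrite mulr_ge0// ltW.
apply: (hc k.+1%:R^-1) => // n.
have [->|nk] := eqVneq n k; first by left.
right; split.
  by apply: gap; apply: contra nk => /eqP/invr_inj/eqP; rewrite eqr_nat eqSS eq_sym.
have -> : T v = fun n => k.+1%:R^-1 * v n.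
  by apply/funext => m; exact: gen_cesaro_eigenvector.
by rewrite bvdiffZ subrr normc0 mulr_ge0// ltW.
Qed.

End generalized_cesaro_weighted.

(** * The real-valued norm of [bv_p] *)

Section bv_space.
Variables (R : realType) (p : R) (p1 : 1 < p).
Local Notation C := R[i].
Local Notation V := (bv p1).
Implicit Types (x y : V) (K B e : R).

Lemma rnorm_bvnorm x : (rnorm x)%:E = bvnorm p x.
Proof. by rewrite /rnorm bv_normE /= fineK// bv_fin_num. Qed.

Lemma rnorm_ge0 x : 0 <= rnorm x.
Proof. by rewrite -lee_fin rnorm_bvnorm bvnorm_ge0. Qed.

Lemma normr_rnorm x : `|x| = (rnorm x)%:C%C.
Proof. by rewrite bv_normE. Qed.

Lemma rnorm_le x r : (bvnorm p x <= r%:E)%E -> rnorm x <= r.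
Proof. by rewrite -rnorm_bvnorm lee_fin. Qed.

Lemma normc_bvdiff_le x k : normc (bvdiff x k) <= rnorm x.
Proof. by rewrite -lee_fin rnorm_bvnorm le_bvdiff. Qed.

Lemma rnormD x y : rnorm (x + y) <= rnorm x + rnorm y.
Proof.
by have := ler_normD x y; rewrite !normr_rnorm -(rmorphD (real_complex R)) lecR.
Qed.

Lemma rnormZ (a : C) x : rnorm (a *: x) = normc a * rnorm x.
Proof.
have : (rnorm (a *: x))%:C%C = (normc a * rnorm x)%:C%C.
  by rewrite -normr_rnorm normrZ normr_rnorm (rmorphM (real_complex R)).
by case.
Qed.

Lemma rnorm_sum (F : nat -> V) m n :
  rnorm (\sum_(m <= i < n) F i) <= \sum_(m <= i < n) rnorm (F i).
Proof.
elim/big_ind2: _ => // [|a b c e ab ce]; first by rewrite /rnorm normr0.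
by rewrite (le_trans (rnormD _ _))// lerD.
Qed.

Lemma rnorm0 : rnorm (0 : V) = 0.
Proof. by rewrite /rnorm normr0. Qed.

Lemma bv_bvdiffB x y k : bvdiff (x - y) k = bvdiff x k - bvdiff y k.
Proof.
case: k => [|k] //; rewrite -[LHS]/((x k.+1 - y k.+1) - (x k - y k)).
by rewrite -[RHS]/((x k.+1 - x k) - (y k.+1 - y k)); ring.
Qed.

End bv_space.

(** * Norms of sequences whose differences are of order [1 / (n + 1)] *)

Section decay.
Variables (R : realType) (p : R).
Local Notation C := R[i].
Implicit Types (x y : nat -> C) (K B e : R).

(** The interpolated bound with [eta = K]: the two exponents of [K] add up to [p], so the result is
    linear in [K]. *)
Lemma bvnorm_decay : 1 < p -> exists2 H : R, 0 <= H & forall x K, 0 <= K ->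
  (forall k, normc (bvdiff x k) <= K / k.+1%:R) -> (bvnorm p x <= (H * K)%:E)%E.
Proof.
move=> p1; have p0 : 0 < p by lra.
exists (((p + 1) / (p - 1)) `^ p^-1); first exact: powR_ge0.
move=> x K K0 xK.
have /(bvnorm_le_interp p1 K0 K0 xK) : forall k, normc (bvdiff x k) <= K.
  by move=> k; rewrite (le_trans (xK k))// ler_piMr// invf_le1// ler1n.
suff -> : (K `^ ((p - 1) / 2) * (K `^ ((p + 1) / 2) * ((p + 1) / (p - 1)))) `^ p^-1 =
  ((p + 1) / (p - 1)) `^ p^-1 * K by [].
have pE : (p - 1) / 2 + (p + 1) / 2 = p by field.
have c0 : 0 <= (p + 1) / (p - 1) by rewrite divr_ge0//; lra.
move: ((p - 1) / 2) ((p + 1) / 2) ((p + 1) / (p - 1)) pE c0 => a b c pE c0.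
rewrite mulrA -powRD; last by rewrite pE gt_eqF.
rewrite pE powRM ?powR_ge0// -powRrM divff ?gt_eqF//.
by rewrite powRr1// mulrC.
Qed.

(** On a Hilbert cube the norm is controlled by the sup norm of the differences, which reduces
    Cauchy estimates to finitely many coordinates. *)
Lemma bvnorm_small K e : 1 < p -> 0 <= K -> 0 < e -> exists2 eta : R, 0 < eta &
  forall x, (forall k, normc (bvdiff x k) <= K / k.+1%:R) ->
    (forall k, normc (bvdiff x k) <= eta) -> (bvnorm p x <= e%:E)%E.
Proof.
move=> p1 K0 e0; have p0 : 0 < p by lra.
set M := K `^ ((p + 1) / 2) * ((p + 1) / (p - 1)).
have M0 : 0 <= M by rewrite mulr_ge0 ?powR_ge0// divr_ge0//; lra.
have M1 : 0 < M + 1 by lra.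
have a0 : 0 < (p - 1) / 2 by lra.
(* Solves [eta^((p - 1) / 2) * (M + 1) = e^p]; [M + 1] replaces [M], which vanishes for [K = 0]. *)
pose eta := (e `^ p / (M + 1)) `^ ((p - 1) / 2)^-1.
have q0 : 0 < e `^ p / (M + 1) by rewrite divr_gt0// powR_gt0.
exists eta; first by rewrite powR_gt0.
move=> x xK xeta; apply: le_trans (bvnorm_le_interp p1 K0 _ xK xeta) _.
  exact: powR_ge0.
rewrite -/M lee_fin /eta -powRrM mulVf ?gt_eqF// powRr1 ?(ltW q0)//.
apply: (@le_trans _ _ ((e `^ p) `^ p^-1)); last first.
  by rewrite -powRrM divff ?gt_eqF// powRr1 ?(ltW e0).
rewrite ge0_ler_powR ?nnegrE ?invr_ge0 ?powR_ge0 ?(ltW p0)//.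
  by rewrite mulr_ge0// ltW.
by rewrite mulrAC ler_pdivrMr// ler_wpM2l ?powR_ge0// lerDl.
Qed.

End decay.

(** * The operator on [bv_p] and its boundedness *)

Section gen_cesaro_operator.
Variables (R : realType) (p : R) (p1 : 1 < p) (t : R).
Hypothesis t01 : 0 <= t < 1.
Local Notation C := R[i].
Local Notation V := (bv p1).

Lemma gen_cesaro_bvnorm : exists2 H : R, 0 <= H & forall (x : nat -> C) B,
  (forall k, normc (bvdiff x k) <= B) -> (bvnorm p (gen_cesaro t x) <= (H * B)%:E)%E.
Proof.
have [H H0 hH] := bvnorm_decay p1; have K1 := cesaro_const_ge1 t01.
exists (H * (cesaro_const t + 1)); first by rewrite mulr_ge0//; lra.
move=> x B xB; rewrite -mulrA hH//; last exact: gen_cesaro_decay.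
have := le_trans (normc_ge0 _) (xB 0%N); nra.
Qed.

Lemma gen_cesaro_in_bv (x : V) : gen_cesaro t x \in bv_pred p1.
Proof.
have [H H0 /(_ x _ (normc_bvdiff_le x)) h] := gen_cesaro_bvnorm.
by apply: le_lt_trans h _; rewrite ltry.
Qed.

Definition cesaro_op (x : V) : V := BV (gen_cesaro_in_bv x).
Local Notation T := cesaro_op.

Lemma cesaro_opE (x : V) : T x = gen_cesaro t x :> (nat -> C).
Proof. by []. Qed.

Lemma cesaro_op_linear : linear T.
Proof.
move=> a x y; apply: bv_eqP => n; rewrite bvD bvZ /=.
by rewrite -gen_cesaroZ -gen_cesaroD.
Qed.

HB.instance Definition _ :=
  GRing.isLinear.Build C V V *:%R cesaro_op cesaro_op_linear.

Lemma cesaro_op_rnorm : exists2 H : R, 0 <= H & forall (x : V) B,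
  (forall k, normc (bvdiff x k) <= B) -> rnorm (T x) <= H * B.
Proof.
by have [H H0 hH] := gen_cesaro_bvnorm; exists H => // x B xB; apply/rnorm_le/hH.
Qed.

Lemma cesaro_op_bounded : bounded_op T.
Proof.
split; first exact: cesaro_op_linear.
have [H H0 hH] := cesaro_op_rnorm; exists H => x.
by apply: hH => k; exact: normc_bvdiff_le.
Qed.

(* A formal solution whose differences are merely bounded is in [bv_p], because
   [gen_cesaro t] maps such sequences into [bv_p]. *)
Lemma bounded_bvdiff_in_bv : exists2 H : R, 0 <= H &
  forall (lam : C) (x : nat -> C) (y : V) B, lam != 0 ->
    (forall n, lam * x n - gen_cesaro t x n = y n) ->
    (forall k, normc (bvdiff x k) <= B) ->
    exists2 z : V, z = x :> (nat -> C) & rnorm z <= (normc lam)^-1 * (rnorm y + H * B).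
Proof.
have [H H0 hH] := gen_cesaro_bvnorm; exists H => // lam x y B lam0 xy xB.
have Tx : gen_cesaro t x \in bv_pred p1 by apply: le_lt_trans (hH _ _ xB) _; rewrite ltry.
exists (lam^-1 *: (y + BV Tx)).
  apply/funext => n; rewrite -[LHS]/(lam^-1 * (y n + gen_cesaro t x n)).
  by rewrite -xy subrK mulKf.
rewrite rnormZ normcV ler_wpM2l ?invr_ge0 ?normc_ge0//.
by rewrite (le_trans (rnormD _ _))// lerD2l rnorm_le// hH.
Qed.

End gen_cesaro_operator.

(** * Compactness of Hilbert cubes in [bv_p] *)

Section compactness.
Variables (R : realType) (p : R) (p1 : 1 < p).
Local Notation C := R[i].
Local Notation V := (bv p1).
Implicit Types (x y : V) (K B e : R).

Lemma bv_ballE x r y : ball x r%:C%C y <-> rnorm (x - y) < r.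
Proof. by rewrite -ball_normE /= normr_rnorm ltcR. Qed.

Lemma bv_ball_nbhs x r : 0 < r -> nbhs x [set y : V | rnorm (x - y) < r].
Proof.
move=> r0; apply/nbhs_ballP; exists r%:C%C; first by rewrite /= ltcR.
by move=> y /bv_ballE.
Qed.

(** The image of [F] has a cluster point in a compact interval, and an ultrafilter converges to each
    of its cluster points. *)
Lemma ultra_bounded_cvg (F : set_system V) (f : V -> R) B : UltraFilter F ->
  F [set y | `|f y| <= B] ->
  exists a, forall e, 0 < e -> F [set y | `|f y - a| < e].
Proof.
move=> FU FB; have FF := @ultra_proper _ _ FU.
have [|a [_ aF]] := @segment_compact R (- B) B (f @ F) _.
  by apply: (@filterS _ F _ _ _ _ FB) => y; rewrite /= in_itv/= -ler_norml.
exists a => e e0.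
have [//|FA] := in_ultra_setVsetC [set y | `|f y - a| < e] FU.
have [_ [[y yA <-] /= ye]] : (f @` ~` [set y | `|f y - a| < e]) `&` ball a e !=set0.
  apply: aF; last exact: nbhsx_ballx.
  by apply: (@filterS _ F _ _ _ _ FA) => y yA; exists y.
by case: yA; rewrite /= distrC; move: ye; rewrite -ball_normE.
Qed.

Lemma ultra_bvdiff_cauchy (F : set_system V) B : UltraFilter F ->
  F [set y | forall n, normc (bvdiff y n) <= B] ->
  forall N eta, 0 < eta -> exists2 S, F S & forall y z, S y -> S z ->
    forall n, (n < N)%N -> normc (bvdiff (y - z) n) <= eta.
Proof.
move=> FU FB; have FF := @ultra_proper _ _ FU.
elim=> [|N IH] eta eta0; first by exists setT => //; exact: filterT.
have [S FS hS] := IH eta eta0.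
have [|a ha] := @ultra_bounded_cvg F (fun y : V => complex.Re (bvdiff y N)) B FU.
  by apply: filterS FB => y /(_ N); apply: le_trans; exact: Re_le_normc.
have [|b hb] := @ultra_bounded_cvg F (fun y : V => complex.Im (bvdiff y N)) B FU.
  by apply: filterS FB => y /(_ N); apply: le_trans; exact: Im_le_normc.
(* The real and imaginary parts of [y] and [z] contribute a quarter each. *)
have eta4 : 0 < eta / 4 by rewrite divr_gt0.
exists (S `&` ([set y : V | `|complex.Re (bvdiff y N) - a| < eta / 4] `&`
  [set y : V | `|complex.Im (bvdiff y N) - b| < eta / 4])).
  exact: (filterI FS (filterI (ha _ eta4) (hb _ eta4))).
move=> y z [Sy [/= ya yb]] [Sz [/= za zb]] n.
rewrite ltnS leq_eqVlt => /predU1P[->|]; last exact: hS.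
rewrite bv_bvdiffB (le_trans (normc_le_ReIm _))// !raddfB/=.
move: ya yb za zb; rewrite !ltr_norml => /andP[? ?] /andP[? ?] /andP[? ?] /andP[? ?].
have -> : eta = eta / 2 + eta / 2 by field.
by apply: lerD; rewrite ler_norml; apply/andP; split; lra.
Qed.

(** An ultrafilter on the cube is Cauchy: finitely many coordinates are settled by
    [ultra_bvdiff_cauchy], the others are small by decay, and [bvnorm_small] turns this into
    smallness in norm. Completeness provides the limit. *)
Lemma bvdiff_decay_compact K : 0 <= K ->
  compact [set y : V | forall n, normc (bvdiff y n) <= K / n.+1%:R].
Proof.
move=> K0; rewrite compact_ultra => F FU FQ; have FF := @ultra_proper _ _ FU.
have FB : F [set y : V | forall n, normc (bvdiff y n) <= K].
  apply: filterS FQ => y h n; rewrite (le_trans (h n))// ler_piMr//.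
  by rewrite invf_le1// ler1n.
have Fcauchy : cauchy F.
  apply/cauchyP => e e0; have /complex_realP[r re] := gtr0_real e0.
  rewrite re ltcR in e0 *.
  have r20 : 0 < r / 2 by rewrite divr_gt0.
  have K20 : 0 <= 2 * K by rewrite mulr_ge0.
  (* The difference of two points of the cube lies in the cube of size [2 * K]. *)
  have [eta eta0 small] := bvnorm_small p1 K20 r20.
  have K21 : 0 < 2 * K + 1 by rewrite ltr_wpDl.
  have [N hN] := invS_le_small (divr_gt0 eta0 K21).
  have [S FS hS] := ultra_bvdiff_cauchy FU FB N eta0.
  have [x [Sx Qx]] := filter_ex (filterI FS FQ).
  exists x; apply: filterS (filterI FS FQ) => y [Sy Qy].
  apply/bv_ballE; apply: (@le_lt_trans _ _ (r / 2)); last first.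
    by rewrite ltr_pdivrMr// ltr_pMr// ltr1n.
  have dec n : normc (bvdiff (x - y) n) <= 2 * K / n.+1%:R.
    rewrite bv_bvdiffB (le_trans (normc_sub _ _))//.
    have -> : 2 * K / n.+1%:R = K / n.+1%:R + K / n.+1%:R by ring.
    by rewrite lerD ?Qx ?Qy.
  apply/rnorm_le/small => // n.
  have [nN|Nn] := ltnP n N; first exact: hS.
  rewrite (le_trans (dec n))// (@le_trans _ _ ((2 * K + 1) * (eta / (2 * K + 1))))//.
    by rewrite ler_pM// ?invr_ge0 ?hN// lerDl.
  by rewrite mulrCA divff ?gt_eqF// mulr1.
have /cvg_ex[l Fl] := bv_cauchy_cvg FF Fcauchy.
(* The limit stays in the cube, as each coordinate is continuous for the norm. *)
exists l; split=> // n; apply/ler_addgt0Pr => e e0.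
have [y [Qy /= ly]] := filter_ex (filterI FQ (Fl _ (bv_ball_nbhs l e0))).
have -> : bvdiff l n = bvdiff y n + bvdiff (l - y) n.
  by rewrite bv_bvdiffB addrC subrK.
rewrite (le_trans (normc_triangle _ _))// lerD ?Qy//.
by rewrite (le_trans (normc_bvdiff_le _ _))// ltW.
Qed.

End compactness.

(** * Compactness of the operator *)

Section cesaro_op_compact.
Variables (R : realType) (p : R) (p1 : 1 < p) (t : R).
Hypothesis t01 : 0 <= t < 1.

Lemma cesaro_op_compact : compact_op (@cesaro_op R p p1 t t01).
Proof.
have K1 := cesaro_const_ge1 t01; set K := cesaro_const t + 1.
have K0 : 0 <= K by rewrite /K; lra.
exists [set y : bv p1 | forall n, normc (bvdiff y n) <= K / n.+1%:R]; last first.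
  split; first exact: bvdiff_decay_compact.
  apply: compact_closed; first exact: norm_hausdorff.
  exact: bvdiff_decay_compact.
move=> _ [x x1 <-] n; rewrite /= -[K]mulr1; apply: gen_cesaro_decay => // k.
exact: le_trans (normc_bvdiff_le _ _) x1.
Qed.

End cesaro_op_compact.

(** * Unit vectors in difference coordinates *)

Section step_vectors.
Variables (R : realType) (p : R) (p1 : 1 < p).
Local Notation C := R[i].
Local Notation V := (bv p1).

(** The sequence that [bvdiff] sends to the [N]-th unit vector of [l_p]. *)
Definition step_seq (N n : nat) : C := (N <= n)%:R.

Lemma bvdiff_step N k : bvdiff (step_seq N) k = (k == N)%:R.
Proof.
case: k => [|k] /=; rewrite /step_seq; first by rewrite leqn0 eq_sym.
case: (ltngtP k.+1 N) => kN.
- by rewrite leqNgt (ltnW kN) subrr.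
- by rewrite -ltnS kN subrr.
- by rewrite -kN ltnn subr0.
Qed.

Lemma bvnorm_step N : (bvnorm p (step_seq N) <= 1%:E)%E.
Proof.
apply: bvnorm_le => // M; rewrite powR1.
have -> : \sum_(k < M) normc (bvdiff (step_seq N) k) `^ p = (N < M)%:R.
  elim: M => [|M IH]; first by rewrite big_ord0.
  have p0 : p != 0 by rewrite gt_eqF// (lt_trans ltr01).
  rewrite big_ord_recr/= IH bvdiff_step normc_nat.
  by rewrite ltnS; case: (ltngtP N M) => NM; rewrite ?powR0 ?powR1 ?addr0 ?add0r.
by case: (N < M)%N.
Qed.

Lemma step_in_bv N : step_seq N \in bv_pred p1.
Proof. exact: le_lt_trans (bvnorm_step N) (ltry _). Qed.

Definition step_bv N : V := BV (step_in_bv N).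

Lemma rnorm_step N : rnorm (step_bv N) <= 1.
Proof. exact/rnorm_le/bvnorm_step. Qed.

End step_vectors.

(** * Point spectrum and spectrum *)

Section cesaro_op_spectrum.
Variables (R : realType) (p : R) (p1 : 1 < p) (t : R).
Hypothesis t01 : 0 <= t < 1.
Local Notation C := R[i].
Local Notation V := (bv p1).
Local Notation T := (@cesaro_op R p p1 t t01).

Lemma exists_cesaro_eigenvector k : exists2 v : V,
  v = cesaro_eigenvector t k :> (nat -> C) & T v = k.+1%:R^-1 *: v.
Proof.
have [B B0 hB] := cesaro_eigenvector_bounded t01 k.
have [H H0 hH] := bounded_bvdiff_in_bv p1 t01.
have k0 : k.+1%:R^-1 != 0 :> C by rewrite invr_eq0 pnatr_eq0.
have [|v vE _] := hH _ (cesaro_eigenvector t k) 0 B k0 _ hB.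
  by move=> n; rewrite gen_cesaro_eigenvector subrr.
exists v => //; apply: bv_eqP => n.
by rewrite cesaro_opE vE gen_cesaro_eigenvector bvZ vE.
Qed.

Lemma cesaro_eigenvector_diag k : cesaro_eigenvector t k k = 1.
Proof. by rewrite /cesaro_eigenvector subnn binn expr0 mulr1. Qed.

Lemma Lambda_eigenvalue lam : Lambda R lam -> point_spectrum T lam.
Proof.
move=> [k _ <-]; have [v vE Tv] := exists_cesaro_eigenvector k.
exists v => //; apply/eqP => v0.
by have := cesaro_eigenvector_diag k; rewrite -vE v0 => /esym/eqP; rewrite oner_eq0.
Qed.

Lemma not_LambdaP lam : ~ Lambda R lam -> forall n, lam != n.+1%:R^-1.
Proof. by move=> hl n; apply/eqP => e; apply: hl; exists n. Qed.

(** The formal solution has bounded differences by [gen_cesaro_apriori], hence lies in [bv_p]; the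
    norm estimate will make the inverse bounded. *)
Lemma cesaro_op_below lam : ~ Lambda0 R lam -> exists2 M : R, 0 <= M &
  forall y : V, exists2 x : V, lam *: x - T x = y & rnorm x <= M * rnorm y.
Proof.
move=> hl; have lam0 : lam != 0 by apply/eqP => l0; apply: hl; right.
have hn : forall n, lam != n.+1%:R^-1 by apply: not_LambdaP => ?; apply: hl; left.
have [delta delta0 gap] := Lambda_gap lam0.
have [c c0 hc] := gen_cesaro_apriori t01 delta0.
have [H H0 hH] := bounded_bvdiff_in_bv p1 t01.
have l0 : 0 <= (normc lam)^-1 by rewrite invr_ge0 normc_ge0.
exists ((normc lam)^-1 * (1 + H * (c * delta^-1))).
  by rewrite mulr_ge0// addr_ge0// mulr_ge0// mulr_ge0 ?invr_ge0 ?ltW.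
move=> y; have [x xy] := exists_gen_cesaro_preimage t y hn.
have xB k : normc (bvdiff x k) <= c * (delta^-1 * rnorm y).
  (* Here [B = rnorm y / delta], so that [delta * B] bounds the residual. *)
  apply: (hc lam x _ _ _ k); first by rewrite mulr_ge0 ?rnorm_ge0 ?invr_ge0 ?ltW.
  move=> n; right; split; first exact: gap.
  rewrite mulVKf ?gt_eqF//; apply: le_trans (normc_bvdiff_le y n).
  suff -> : bvdiff y n = lam * bvdiff x n - bvdiff (gen_cesaro t x) n by [].
  by case: n => [|n] /=; rewrite -!xy//; ring.
have [z zx hz] := hH _ _ _ _ lam0 xy xB.
exists z; first by apply: bv_eqP => n; rewrite bvD bvN bvZ cesaro_opE zx xy.
by apply: le_trans hz _; rewrite -mulrA ler_wpM2l// mulrDl mul1r !mulrA.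
Qed.

Lemma cesaro_op_inj lam (x : V) : ~ Lambda0 R lam -> lam *: x = T x -> x = 0.
Proof.
move=> hl lx; have lam0 : lam != 0 by apply/eqP => l0; apply: hl; right.
have hn : forall n, lam != n.+1%:R^-1 by apply: not_LambdaP => ?; apply: hl; left.
have [delta delta0 gap] := Lambda_gap lam0.
have [c c0 hc] := gen_cesaro_apriori t01 delta0.
apply: val_inj; apply: bvdiff0 => k; apply: eq0_normc; apply/eqP.
rewrite eq_le normc_ge0 andbT -(mulr0 c).
apply: (hc lam x 0 _ _ k) => // n; right; split; first exact: gap.
have -> : gen_cesaro t x = (fun n => lam * x n) by rewrite -cesaro_opE -lx.
by rewrite bvdiffZ subrr normc0 mulr0.
Qed.

Lemma cesaro_op_inj0 (x : V) : T x = 0 -> x = 0.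
Proof.
move=> Tx.
have s0 n : cesaro_sum t x n = 0.
  have : gen_cesaro t x n = 0 by rewrite -cesaro_opE Tx.
  rewrite gen_cesaroE => /eqP; rewrite mulf_eq0 invr_eq0 pnatr_eq0 orbF.
  by move/eqP.
apply: bv_eqP => -[|n]; first by rewrite -(cesaro_sum0 t) s0.
by have := cesaro_sumS t x n; rewrite !s0 mulr0 add0r => <-.
Qed.

Lemma cesaro_op_point_spectrum : point_spectrum T = Lambda R.
Proof.
apply/seteqP; split=> lam; last exact: Lambda_eigenvalue.
move=> [x x0 Tx]; apply: contrapT => hl; move/eqP: x0; apply.
have [l0|l0] := eqVneq lam 0.
  by apply: cesaro_op_inj0; rewrite Tx l0 scale0r.
by apply: (@cesaro_op_inj lam) => // -[//|/eqP]; rewrite (negbTE l0).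
Qed.

(** A bounded inverse would provide vectors [x] of norm at most [|M|] with [T x = - step_bv N]. The
    [N]-th difference of [T x] is at most [K * |M| / (N + 1)], but that of [step_bv N] is [1], a
    contradiction for large [N]. *)
Lemma zero_in_spectrum : spectrum T 0.
Proof.
move=> [S [[_ [M hM]] _ TS]].
have K1 := cesaro_const_ge1 t01; set K := cesaro_const t + 1.
have K0 : 0 <= K by rewrite /K; lra.
have A0 : 0 <= K * `|M| by rewrite mulr_ge0.
pose N := Num.bound (K * `|M|); have := TS (step_bv p1 N).
set x := S _; rewrite scale0r sub0r => Tx.
have xM : rnorm x <= `|M|.
  apply: le_trans (hM _) _; rewrite (@le_trans _ _ (`|M| * rnorm (step_bv p1 N)))//.
    by rewrite ler_wpM2r ?rnorm_ge0 ?ler_norm.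
  by rewrite ler_piMr// rnorm_step.
have : normc (bvdiff (T x) N) <= K * `|M| / N.+1%:R.
  by apply: gen_cesaro_decay => // k; apply: le_trans (normc_bvdiff_le _ _) xM.
have -> : T x = - step_bv p1 N by rewrite -Tx opprK.
rewrite -[- step_bv p1 N]sub0r bv_bvdiffB bvdiff_step eqxx.
have -> : bvdiff (0 : V) N = 0 by case: N {Tx xM x} => [|N] //=; rewrite subrr.
rewrite sub0r normc_opp normc1 ler_pdivlMr// mul1r.
by have := archi_boundP A0; rewrite -natr1 -/N; lra.
Qed.

Lemma cesaro_op_spectrum : spectrum T = Lambda0 R.
Proof.
apply/seteqP; split=> lam; last first.
  move=> [/Lambda_eigenvalue[x x0 Tx]|->]; last exact: zero_in_spectrum.
  move=> [S [_ TS _]]; move/eqP: x0; apply.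
  have S0 : S 0 = 0 by rewrite -[RHS]TS !linear0 addr0.
  by have := TS x; rewrite Tx subrr S0.
move=> hl; apply: contrapT => nl; apply: hl.
have [M M0 hM] := cesaro_op_below nl.
have uniq (x x' : V) : lam *: x - T x = lam *: x' - T x' -> x = x'.
  move=> e; apply/eqP; rewrite -subr_eq0; apply/eqP/(cesaro_op_inj nl).
  rewrite !linearB /= -[lam *: x](subrK (T x)) e.
  by rewrite addrAC [_ - T x' - _]addrAC subrr sub0r addrC.
(* Preimages are chosen pointwise; linearity of the choice follows from [uniq]. *)
have /choice[S hS] : forall y : V, exists x : V,
    lam *: x - T x = y /\ rnorm x <= M * rnorm y.
  by move=> y; have [x] := hM y; exists x.
exists S; split.
- split; last by exists M => y; have [] := hS y.
  move=> a x y; apply: uniq; have [-> _] := hS (a *: x + y).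
  rewrite -[in LHS](proj1 (hS x)) -[in LHS](proj1 (hS y)) !linearP /=.
  by rewrite addrACA !scalerA [lam * a]mulrC.
- by move=> x; apply: uniq; have [] := hS (lam *: x - T x).
- by move=> y; have [] := hS y.
Qed.

End cesaro_op_spectrum.

(** * Powers, ergodic means and orbits *)

Section cesaro_op_dynamics.
Variables (R : realType) (p : R) (p1 : 1 < p) (t : R).
Hypothesis t01 : 0 <= t < 1.
Local Notation C := R[i].
Local Notation V := (bv p1).
Local Notation T := (@cesaro_op R p p1 t t01).

Lemma iter_cesaro_opE m (x : V) : iter m T x = iter m (gen_cesaro t) x :> (nat -> C).
Proof. by elim: m => //= m ->. Qed.

Lemma cesaro_op_head (x : V) : T x 0%N = x 0%N.
Proof. by rewrite cesaro_opE gen_cesaroE cesaro_sum0 divr1. Qed.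

Lemma iter_cesaro_op_head m (x : V) : iter m T x 0%N = x 0%N.
Proof. by elim: m => // m IH; rewrite iterS cesaro_op_head. Qed.

Lemma iter_cesaro_op_linear m : linear (iter m T).
Proof. by move=> a x y; elim: m => //= m ->; rewrite linearP. Qed.

Lemma normc_head_le (x : V) : normc (x 0%N) <= rnorm x.
Proof. exact: (normc_bvdiff_le x 0). Qed.

Lemma iter_cesaro_op_cvg : exists (v : V) (M : R), 0 <= M /\
  forall (x : V) m, rnorm (iter m.+1 T x - x 0%N *: v) <= M * (3 / 4) ^+ m * rnorm x.
Proof.
have [v vE] := exists_cesaro_eigenvector p1 t01 0; rewrite invr1 scale1r => Tv.
exists v.
have v0 : v 0%N = 1 by rewrite vE cesaro_eigenvector_diag.
have itv m : iter m T v = v by elim: m => //= m ->.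
have [c c0 hc] := gen_cesaro_iter_decay t01.
have [H H0 hH] := cesaro_op_rnorm p1 t01.
have V0 := rnorm_ge0 v.
exists (H * (c * (1 + rnorm v))); split.
  by rewrite mulr_ge0// mulr_ge0 ?(ltW c0)// addr_ge0.
move=> x m; set u := - x 0%N *: v + x.
have uE : iter m.+1 T x - x 0%N *: v = iter m.+1 T u.
  by rewrite iter_cesaro_op_linear itv scaleNr addrC.
have u0 : u 0%N = 0 by rewrite bvD bvZ v0 mulr1 addNr.
have uM : rnorm u <= (1 + rnorm v) * rnorm x.
  apply: le_trans (rnormD _ _) _; rewrite rnormZ normc_opp mulrDl mul1r addrC lerD2l.
  by rewrite mulrC ler_wpM2l// normc_head_le.
(* Of the [m + 1] applications the outermost passes from the sup norm of the differences to the norm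
   of [bv_p]; the other [m] give the decay. *)
rewrite uE iterS.
have -> : H * (c * (1 + rnorm v)) * (3 / 4) ^+ m * rnorm x =
    H * (c * ((1 + rnorm v) * rnorm x) * (3 / 4) ^+ m) by ring.
apply: hH => k; rewrite iter_cesaro_opE; apply: hc => // n.
exact: le_trans (normc_bvdiff_le _ _) uM.
Qed.

Lemma opnorm_le (f : V -> V) M : 0 <= M -> (forall x, rnorm (f x) <= M * rnorm x) ->
  (opnorm f <= M%:E)%E.
Proof.
move=> M0 fM; apply: ge_ereal_sup => _ [x /= x1 <-].
by rewrite lee_fin (le_trans (fM x))// ler_piMr.
Qed.

Lemma opnorm_ge0 (f : V -> V) : (0 <= opnorm f)%E.
Proof.
apply: (@le_trans _ _ (rnorm (f 0))%:E); first by rewrite lee_fin rnorm_ge0.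
by apply: ereal_sup_ubound; exists 0 => //=; rewrite rnorm0.
Qed.

(** The powers stay within [M] of the limit projection, whose norm is at most [rnorm v]. *)
Lemma cesaro_op_power_bounded : power_bounded T.
Proof.
have [v [M [M0 hM]]] := iter_cesaro_op_cvg.
apply: (@le_lt_trans _ _ (M + rnorm v)%:E); last exact: ltry.
apply: ge_ereal_sup => _ [[//|m] _ <-].
have V0 := rnorm_ge0 v.
apply: opnorm_le => [|x]; first exact: addr_ge0.
rewrite -[iter _ _ _](subrK (x 0%N *: v)) (le_trans (rnormD _ _))// mulrDl lerD//.
  apply: le_trans (hM x m) _; rewrite ler_wpM2r ?rnorm_ge0// ler_piMr//.
  by rewrite exprn_ile1//; lra.
by rewrite rnormZ mulrC ler_wpM2l// normc_head_le.
Qed.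

Lemma geometric_sum_le n : \sum_(1 <= m < n.+1) (3 / 4 : R) ^+ m.-1 <= 4.
Proof.
rewrite big_add1 /=.
suff -> : \sum_(0 <= m < n) (3 / 4 : R) ^+ m = 4 * (1 - (3 / 4) ^+ n).
  have : 0 <= (3 / 4 : R) ^+ n by rewrite exprn_ge0//; lra.
  lra.
elim: n => [|n IH]; first by rewrite big_nil expr0 subrr mulr0.
by rewrite big_nat_recr//= IH exprS; field.
Qed.

(** The errors of the powers are summable, so the error of the [n]-th mean is at most
    [4 * M / n]. *)
Lemma cesaro_op_uniformly_mean_ergodic : uniformly_mean_ergodic T.
Proof.
have [v [M [M0 hM]]] := iter_cesaro_op_cvg.
have V0 := rnorm_ge0 v.
exists (fun x : V => x 0%N *: v).
  split; first by move=> a x y; rewrite bvD bvZ scalerDl scalerA.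
  by exists (rnorm v) => x; rewrite rnormZ mulrC ler_wpM2l// normc_head_le.
(* Drops the mean of index [0], whose factor [0^-1] is only a default value. *)
suff H : opnorm (fun x : V => cesaro_mean T n.+1 x - x 0%N *: v)
    @[n --> \oo] --> 0%E.
  by rewrite -cvg_shiftS; exact: H.
apply: (@squeeze_cvge nat \oo _ R (cst 0%E) _
  (fun n => (4 * M * harmonic n)%:E)); last 2 first.
- exact: cvg_cst.
- apply: cvg_EFin; first exact: nearW.
  rewrite -[X in _ --> X](mulr0 (4 * M)).
  exact: (cvgM (cvg_cst (4 * M)) cvg_harmonic).
apply: nearW => n; rewrite opnorm_ge0/=.
apply: opnorm_le => [|x]; first by rewrite !mulr_ge0// invr_ge0.
have -> : cesaro_mean T n.+1 x - x 0%N *: v =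
    n.+1%:R^-1 *: \sum_(1 <= m < n.+2) (iter m T x - x 0%N *: v).
  rewrite sumrB scalerBr; congr (_ - _).
  rewrite sumr_const_nat subn1 /= -[X in _ = _ *: X]scaler_nat [RHS]scalerA mulVf; last first.
    by rewrite pnatr_eq0.
  by rewrite scale1r.
rewrite rnormZ normc_natV [_ * n.+1%:R^-1]mulrC -mulrA ler_wpM2l ?invr_ge0//.
apply: le_trans (rnorm_sum _ _ _) _.
apply: (@le_trans _ _ (\sum_(1 <= m < n.+2) M * rnorm x * (3 / 4) ^+ m.-1)).
  rewrite !big_nat; apply: ler_sum => -[//|m] _.
  by rewrite mulrAC; exact: hM.
rewrite -mulr_sumr mulrC -[4 * M * _]mulrA.
by rewrite ler_wpM2r ?mulr_ge0 ?rnorm_ge0// geometric_sum_le.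
Qed.

(* The two functionals [x 0] and [x 1 - t * x 0] are eigenvectors of the adjoint,
   for the eigenvalues [1] and [1 / 2]: along an orbit their ratio stays bounded. *)
Definition second_functional (x : nat -> C) : C := x 1%N - t%:C%C * x 0%N.
Local Notation f1 := second_functional.

Lemma second_functional_cesaro_op (x : V) : f1 (T x) = 2^-1 * f1 x.
Proof.
rewrite /f1 cesaro_op_head cesaro_opE gen_cesaroE cesaro_sumS cesaro_sum0.
by field.
Qed.

Lemma normc_second_functional_iter m (x : V) : normc (f1 (iter m T x)) <= normc (f1 x).
Proof.
elim: m => //= m IH; rewrite second_functional_cesaro_op normcM normc_natV.
by rewrite (le_trans _ IH)// ler_piMl ?normc_ge0// invf_le1// ler1n.
Qed.

Lemma normc_second_functional_le (x : V) : normc (f1 x) <= 2 * rnorm x.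
Proof.
have -> : f1 x = bvdiff x 1 + (1 - t)%:C%C * bvdiff x 0.
  by rewrite /f1 /= (rmorphB (real_complex R)) rmorph1; ring.
rewrite (le_trans (normc_triangle _ _))// mulrDl mul1r lerD ?normc_bvdiff_le//.
have /andP[t0 t1] := t01.
rewrite normcM normc_real (le_trans _ (normc_head_le x))// ler_piMl ?normc_ge0//.
by rewrite ger0_norm; lra.
Qed.

(** If [x 0 = 0], all multiples of orbit points have head [0] and keep distance at least [1] from
    the constant sequence [1]. Otherwise they all satisfy [normc (f1 y) <= A * normc (y 0)], whereas
    [step_bv 1] has head [0] and [f1] equal to [1]. *)
Lemma cesaro_op_not_supercyclic : ~ supercyclic T.
Proof.
move=> [x xd].
have orbit (z : V) r : 0 < r ->
    exists (l : C) n, rnorm (z - l *: iter n T x) < r.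
  move=> r0; have rC : 0 < r%:C%C :> C by rewrite ltcR.
  have [y [/bv_ballE zy [l [n yE]]]] := xd (ball z r%:C%C)
    (ex_intro _ z (ballxx z rC)) (ball_open z r%:C%C).
  by exists l, n; rewrite -yE.
have [x0|x0] := eqVneq (x 0%N) 0.
  have [l [n]] := orbit (step_bv p1 0) 1 ltr01.
  apply/negP; rewrite -leNgt; apply: le_trans (normc_head_le _).
  rewrite bvD bvN bvZ iter_cesaro_op_head x0 mulr0 subr0.
  by have -> : step_bv p1 0 0%N = 1 by []; rewrite normc1.
have x0n : 0 < normc (x 0%N).
  rewrite lt_neqAle normc_ge0 andbT eq_sym; apply: contra x0 => /eqP.
  by move/eq0_normc ->.
pose A := normc (f1 x) / normc (x 0%N).
have A0 : 0 <= A by rewrite divr_ge0 ?normc_ge0.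
(* The radius [r] solves [2 * r + A * r = 1]: [f1] has norm at most [2], the head functional norm at
   most [1]. *)
have r0 : 0 < (A + 2)^-1 by rewrite invr_gt0; lra.
have [l [n hn]] := orbit (step_bv p1 1) _ r0.
set y := l *: iter n T x in hn.
have y0 : normc (y 0%N) < (A + 2)^-1.
  apply: le_lt_trans hn; apply: le_trans (normc_head_le _).
  by rewrite bvD bvN [step_bv _ _ _]/= /step_seq sub0r normc_opp.
have f1y : normc (f1 y) <= A * normc (y 0%N).
  have -> : f1 y = l * f1 (iter n T x) by rewrite /f1 /y !bvZ; ring.
  have -> : A * normc (y 0%N) = normc l * normc (f1 x).
    by rewrite /A /y bvZ iter_cesaro_op_head normcM mulrCA divfK// gt_eqF.
  by rewrite normcM ler_wpM2l ?normc_ge0// normc_second_functional_iter.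
have f1s : f1 (step_bv p1 1) = 1 by rewrite /f1 /= /step_seq mulr0 subr0.
have h : normc (f1 (step_bv p1 1 - y)) < 2 * (A + 2)^-1.
  by apply: le_lt_trans (normc_second_functional_le _) _; rewrite ltr_pM2l.
have e : 1 = f1 (step_bv p1 1 - y) + f1 y.
  by rewrite -f1s /f1 !bvD !bvN; ring.
have : normc (1 : C) <= normc (f1 (step_bv p1 1 - y)) + normc (f1 y).
  by rewrite {1}e normc_triangle.
rewrite normc1; apply/negP; rewrite -ltNge.
have f1y' : normc (f1 y) <= A * (A + 2)^-1.
  by apply: le_trans f1y _; rewrite ler_wpM2l// ltW.
apply: lt_le_trans (ltr_leD h f1y') _.
by rewrite -mulrDl addrC divff// gt_eqF//; lra.
Qed.

End cesaro_op_dynamics.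

Theorem proposition11p4 (R : realType) (p : R) (p1 : 1 < p) (t : R)
    (t01 : 0 <= t < 1) :
  exists T : bv p1 -> bv p1,
    (forall (x : bv p1) (n : nat), T x n = gen_cesaro t x n) /\
    bounded_op T /\
    compact_op T /\
    point_spectrum T = Lambda R /\
    spectrum T = Lambda0 R /\
    power_bounded T /\
    uniformly_mean_ergodic T /\
    ~ supercyclic T.
Proof.
exists (cesaro_op t01); split; first by [].
split; first exact: cesaro_op_bounded.
split; first exact: cesaro_op_compact.
split; first exact: cesaro_op_point_spectrum.
split; first exact: cesaro_op_spectrum.
split; first exact: cesaro_op_power_bounded.
split; first exact: cesaro_op_uniformly_mean_ergodic.
exact: cesaro_op_not_supercyclic.
Qed.
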